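(* The following equalities of classes of operators hold: $$\mathscr X^*=\mathscr X\cap\mathscr D=\mathscr X\cap\bigcup_{\alpha\in\mathrm{Ord}}\mathscr{SZ}_\alpha=\mathscr X\cap\bigcup_{\alpha<\omega_1}\mathscr{SZ}_\alpha=\mathscr X\cap\mathscr{SZ}_{\omega_1}.$$
   Context: Banach spaces are over $\mathbb K\in\{\mathbb R,\mathbb C\}$; an operator is a bounded linear map between Banach spaces; $\mathscr B(E,F)$ is the space of operators $E\to F$; $B_E$ is the closed unit ball of $E$; $T^*$ is the adjoint of $T$; $\mathrm{Ord}$ is the class of all ordinals. $\mathscr X$ is the class of operators with norm-separable range; $\mathscr X^*$ is the class of operators $T$ with $T^*\in\mathscr X$; $\mathscr D$ is the class of Asplund operators. An operator $T:E\to F$ is Asplund if for any finite positive measure space $(\Omega,\Sigma,\mu)$, any $S\in\mathscr B(F,L_\infty(\Omega,\Sigma,\mu))$ and any $\varepsilon>0$, there exists $B\in\Sigma$ such that $\mu(B)>\mu(\Omega)-\varepsilon$ and $\{f\chi_B : f\in ST(B_E)\}$ is relatively compact in $L_\infty(\Omega,\Sigma,\mu)$, where $\chi_B$ is the characteristic function of $B$. Szlenk index. Let $E$ be a Banach space, $K\subseteq E^*$ a $w^*$-compact set and $\varepsilon>0$. Put $s_\varepsilon(K)=\{x\in K : \operatorname{diam}(K\cap V)>\varepsilon \text{ for every } w^*\text{-open } V\ni x\}$ (norm diameter), $s^0_\varepsilon(K)=K$, $s^{\alpha+1}_\varepsilon(K)=s_\varepsilon(s^\alpha_\varepsilon(K))$,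 and $s^\alpha_\varepsilon(K)=\bigcap_{\beta<\alpha}s^\beta_\varepsilon(K)$ for limit ordinals $\alpha$. $\mathrm{Sz}_\varepsilon(K)$ is the class of all ordinals $\alpha$ with $s^\alpha_\varepsilon(K)\neq\emptyset$; that is, the least ordinal $\alpha$ with $s^\alpha_\varepsilon(K)=\emptyset$ if one exists, and otherwise the class of all ordinals, written $\infty$. $\mathrm{Sz}(K)=\bigcup_{\varepsilon>0}\mathrm{Sz}_\varepsilon(K)=\sup_{\varepsilon>0}\mathrm{Sz}_\varepsilon(K)$. For an operator $T:E\to F$, $\mathrm{Sz}(T)=\mathrm{Sz}(T^*B_{F^*})$. $\mathscr{SZ}_\alpha$ is the class of all operators $T$ with $\mathrm{Sz}(T)\leqslant\omega^\alpha$. *)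

(* Defs.v *)
From HB Require Import structures.
From mathcomp Require Import all_boot all_order all_algebra.
From mathcomp Require Import generic_quotient ring_quotient complex.
From mathcomp Require Import all_classical all_reals all_analysis.
From mathcomp Require Import measurable_realfun ess_sup_inf.

Set Implicit Arguments.
Unset Strict Implicit.
Unset Printing Implicit Defensive.
Import Order.TTheory GRing.Theory Num.Theory.
Import numFieldNormedType.Exports.

Local Open Scope classical_set_scope.
Local Open Scope ring_scope.

Variant scalar_kind := RealScalars | ComplexScalars.

Definition scalars (R : realType) (k : scalar_kind) : numFieldType :=
  match k with
  | RealScalars => R
  | ComplexScalars => R[i]
  end.

Section ScalarParts.
Variables (R : realType) (k : scalar_kind).
Local Notation K := (scalars R k).

Definition of_real : R -> K :=
  match k return R -> scalars R k with
  | RealScalars => idfun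
  | ComplexScalars => fun x => Complex x 0
  end.

Definition re_part : K -> R :=
  match k return scalars R k -> R with
  | RealScalars => idfun
  | ComplexScalars => @complex.Re R
  end.

Definition im_part : K -> R :=
  match k return scalars R k -> R with
  | RealScalars => fun=> 0
  | ComplexScalars => @complex.Im R
  end.

End ScalarParts.
Arguments of_real {R k} _.
Arguments re_part {R k} _.
Arguments im_part {R k} _.

(* Norms of normed modules over K take their values in K; [rnorm] is the same
   number seen in R, see [of_real_rnorm]. *)
Definition rnorm {R : realType} {k : scalar_kind}
    {V : normedModType (scalars R k)} (x : V) : R := re_part `|x|.

Section ScalarTheory.
Variables (R : realType) (k : scalar_kind).
Local Notation K := (scalars R k).
Implicit Types (x y : R) (z w : K) (V : normedModType K).

Lemma of_realK : cancel (@of_real R k) re_part.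
Proof. by case: k. Qed.

Lemma ler_of_real x y : (of_real x <= of_real y :> K) = (x <= y).
Proof. by case: k => //=; rewrite lecE /= eqxx. Qed.

Lemma of_realD x y : of_real (x + y) = of_real x + of_real y :> K.
Proof. by case: k => //=; exact: (rmorphD (real_complex R)). Qed.

Lemma of_realM x y : of_real (x * y) = of_real x * of_real y :> K.
Proof. by case: k => //=; exact: (rmorphM (real_complex R)). Qed.

Lemma of_real0 : of_real 0 = 0 :> K.
Proof. by case: k. Qed.

Lemma of_real1 : of_real 1 = 1 :> K.
Proof. by case: k. Qed.

Lemma re_partD z w : re_part (z + w) = re_part z + re_part w.
Proof. by case: k z w => //= -[a b] [c d]. Qed.

Lemma im_partD z w : im_part (z + w) = im_part z + im_part w.
Proof. by case: k z w => /= [*|[a b] [c d] //]; rewrite addr0. Qed.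

Lemma re_partM z w :
  re_part (z * w) = re_part z * re_part w - im_part z * im_part w.
Proof. by case: k z w => /= [*|[a b] [c d] //]; rewrite mul0r subr0. Qed.

Lemma im_partM z w :
  im_part (z * w) = re_part z * im_part w + im_part z * re_part w.
Proof. by case: k z w => /= [*|[a b] [c d] //]; rewrite mulr0 mul0r addr0. Qed.

Lemma re_part0 : re_part (0 : K) = 0.
Proof. by case: k. Qed.

Lemma im_part0 : im_part (0 : K) = 0.
Proof. by case: k. Qed.

Lemma of_real_ge0 z : 0 <= z -> of_real (re_part z) = z.
Proof.
by case: k z => //= -[a b]; rewrite lecE /= => /andP[/eqP -> _].
Qed.

Lemma of_real_rnorm V (x : V) : of_real (rnorm x) = `|x|.
Proof. exact: of_real_ge0. Qed.

Lemma rnorm_ge0 V (x : V) : 0 <= rnorm x.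
Proof. by rewrite -ler_of_real of_real_rnorm of_real0. Qed.

Lemma ler_rnormD V (x y : V) : rnorm (x + y) <= rnorm x + rnorm y.
Proof. by rewrite -ler_of_real of_realD !of_real_rnorm ler_normD. Qed.

Lemma rnormZ V (a : K^o) (x : V) : rnorm (a *: x) = rnorm a * rnorm x.
Proof.
apply: (can_inj of_realK).
by rewrite of_realM !of_real_rnorm normrZ.
Qed.

Lemma rnorm0 V : rnorm (0 : V) = 0.
Proof. by rewrite /rnorm normr0 re_part0. Qed.

Lemma rnorm_eq0 V (x : V) : rnorm x = 0 -> x = 0.
Proof.
by move=> x0; apply/normr0_eq0; rewrite -of_real_rnorm x0 of_real0.
Qed.

Definition closed_unit_ball V : set V :=
  [set x | `|x| <= 1].

Lemma closed_unit_ballP V (x : V) :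
  closed_unit_ball x <-> rnorm x <= 1.
Proof. by rewrite /closed_unit_ball/= -ler_of_real of_real_rnorm of_real1. Qed.

End ScalarTheory.
Arguments closed_unit_ball {R k} V _.

Section Operators.
Variables (R : realType) (k : scalar_kind).
Local Notation K := (scalars R k).
Variables E F : normedModType K.

Definition bounded_linear : {pred E -> F} :=
  mem [set f : E -> F |
    linear f /\ exists M : K, forall x, `|f x| <= M * `|x|].

Record operator := Operator {
  operator_fun :> E -> F;
  operatorP : operator_fun \in bounded_linear
}.

HB.instance Definition _ := [isSub for operator_fun].
HB.instance Definition _ := [Choice of operator by <:].

Lemma bounded_linearP (f : E -> F) :
  f \in bounded_linear <->
  linear f /\ exists2 M : R, 0 <= M & forall x, rnorm (f x) <= M * rnorm x.
Proof.
rewrite inE /=; split => -[fl] [M].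
  move=> fM; split=> //; exists (rnorm (M : K^o)); first exact: rnorm_ge0.
  move=> x; rewrite -(ler_of_real k) of_realM !of_real_rnorm.
  have := fM x; have [->|x0 fMx] := eqVneq x 0; first by rewrite normr0 !mulr0.
  rewrite ger0_norm// -(pmulr_lge0 _ (_ : 0 < `|x|)) ?normr_gt0//.
  exact: le_trans fMx.
move=> _ fM; split=> //; exists (of_real M) => x.
by rewrite -!of_real_rnorm -of_realM ler_of_real.
Qed.

Lemma bounded_linear_submod_closed : submod_closed bounded_linear.
Proof.
split.
  apply/bounded_linearP; split; first by move=> a x y; rewrite scaler0 addr0.
  by exists 0 => // x; rewrite rnorm0 mul0r.
move=> a f g /bounded_linearP[fl [M M0 fM]] /bounded_linearP[gl [N N0 gN]].
apply/bounded_linearP; split.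
  move=> b x y; rewrite !fctE fl gl !scalerDr !scalerA [a * b]mulrC.
  by rewrite addrACA.
exists (rnorm (a : K^o) * M + N); first by rewrite addr_ge0// mulr_ge0// rnorm_ge0.
move=> x; rewrite !fctE (le_trans (ler_rnormD _ _))// rnormZ mulrDl lerD// -mulrA.
by rewrite ler_wpM2l// rnorm_ge0.
Qed.

HB.instance Definition _ := GRing.isSubmodClosed.Build _ _ bounded_linear
  bounded_linear_submod_closed.
HB.instance Definition _ := [SubChoice_isSubLmodule of operator by <:].

Lemma operator_linear (T : operator) : linear T.
Proof. by have /bounded_linearP[] := operatorP T. Qed.

HB.instance Definition _ (T : operator) :=
  GRing.isLinear.Build K E F *:%R T (@operator_linear T).

Lemma operator_bounded (T : operator) :
  exists2 M : R, 0 <= M & forall x, rnorm (T x) <= M * rnorm x.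
Proof. by have /bounded_linearP[] := operatorP T. Qed.

Definition operator_norm (T : operator) : R :=
  sup [set rnorm (T x) | x in closed_unit_ball E].

Lemma operator_norm_ub (T : operator) x :
  rnorm (T x) <= operator_norm T * rnorm x.
Proof.
have [->|x0] := eqVneq x 0; first by rewrite linear0 !rnorm0 mulr0.
have nx0 : 0 < rnorm x.
  by rewrite lt_neqAle rnorm_ge0 andbT eq_sym; apply: contra_neq x0 => /rnorm_eq0.
have nx0' : rnorm (of_real (rnorm x)^-1 : K^o) = (rnorm x)^-1.
  by rewrite /rnorm ger0_norm ?of_realK// -(of_real0 R k) ler_of_real invr_ge0 ltW.
rewrite -ler_pdivrMr// mulrC -nx0' -rnormZ -linearZ.
apply: ub_le_sup.
  have [M M0 TM] := operator_bounded T.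
  exists M => _ [y /closed_unit_ballP y1 <-].
  by rewrite (le_trans (TM y))// ler_piMr.
exists (of_real (rnorm x)^-1 *: x) => //.
by apply/closed_unit_ballP; rewrite rnormZ nx0' mulVf// gt_eqF.
Qed.

Lemma operator_norm_le (T : operator) (M : R) : 0 <= M ->
  (forall x, rnorm (T x) <= M * rnorm x) -> operator_norm T <= M.
Proof.
move=> M0 TM; apply: ge_sup.
  by exists (rnorm (T 0)), 0 => //; apply/closed_unit_ballP; rewrite rnorm0.
move=> _ [x /closed_unit_ballP x1 <-].
by rewrite (le_trans (TM x))// ler_piMr.
Qed.

Lemma operator_norm_ge0 (T : operator) : 0 <= operator_norm T.
Proof.
have [M M0 TM] := operator_bounded T.
rewrite (le_trans (rnorm_ge0 (T 0)))//; apply: ub_le_sup.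
  exists M => _ [y /closed_unit_ballP y1 <-].
  by rewrite (le_trans (TM y))// ler_piMr.
by exists 0 => //; apply/closed_unit_ballP; rewrite rnorm0.
Qed.

Let opnorm (T : operator) : K := of_real (operator_norm T).

Lemma ler_opnormD (S T : operator) : opnorm (S + T) <= opnorm S + opnorm T.
Proof.
rewrite -of_realD ler_of_real operator_norm_le ?addr_ge0 ?operator_norm_ge0//.
by move=> x; rewrite mulrDl (le_trans (ler_rnormD _ _))// lerD// operator_norm_ub.
Qed.

Lemma opnormZ (a : K) (T : operator) : opnorm (a *: T) = `|a| * opnorm T.
Proof.
rewrite -(of_real_rnorm (a : K^o)) -of_realM; congr of_real.
apply/le_anti/andP; split.
  apply: operator_norm_le; first by rewrite mulr_ge0 ?rnorm_ge0 ?operator_norm_ge0.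
  by move=> x; rewrite [_ x]/(a *: T x) rnormZ -mulrA ler_wpM2l ?rnorm_ge0 ?operator_norm_ub.
have [->|a0] := eqVneq a 0.
  by rewrite rnorm0 mul0r operator_norm_ge0.
have na0 : 0 < rnorm (a : K^o).
  by rewrite lt_neqAle rnorm_ge0 andbT eq_sym; apply: contra_neq a0 => /rnorm_eq0.
rewrite -ler_pdivlMl//; apply: operator_norm_le.
  by rewrite mulr_ge0 ?operator_norm_ge0// invr_ge0 ltW.
move=> x; rewrite -mulrA ler_pdivlMl// -rnormZ.
exact: (operator_norm_ub (a *: T)).
Qed.

Lemma opnorm0_eq0 (T : operator) : opnorm T = 0 -> T = 0.
Proof.
rewrite -(of_real0 R k) => /(can_inj (@of_realK R k)) T0.
apply/val_inj/funext => x; apply: rnorm_eq0; apply/le_anti.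
by rewrite rnorm_ge0 andbT (le_trans (operator_norm_ub T x))// T0 mul0r.
Qed.

HB.instance Definition _ := @Lmodule_isNormed.Build K operator
  opnorm ler_opnormD opnormZ opnorm0_eq0.

Lemma rnorm_operator (T : operator) : rnorm T = operator_norm T.
Proof. exact: of_realK. Qed.

End Operators.

Section Duality.
Variables (R : realType) (k : scalar_kind).
Local Notation K := (scalars R k).

Definition dual (E : normedModType K) : normedModType K := operator E K^o.

(* The weak* topology is the trace on the dual of the topology of pointwise
   convergence on E -> K. *)
Definition weak_star (E : normedModType K) : topologicalType :=
  initial_topology (fun (phi : dual E) => (phi : {ptws E -> K^o})).

Section Adjoint.
Variables (E F : normedModType K) (T : operator E F).

Lemma adjoint_fun_subproof (psi : dual F) :
  (psi \o T : E -> K^o) \in @bounded_linear _ _ E K^o.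
Proof.
apply/bounded_linearP; split; first by move=> a x y /=; rewrite !linearP.
exists (operator_norm psi * operator_norm T).
  by rewrite mulr_ge0 ?operator_norm_ge0.
move=> x /=; rewrite (le_trans (operator_norm_ub psi _))// -mulrA.
by rewrite ler_wpM2l ?operator_norm_ge0 ?operator_norm_ub.
Qed.

Definition adjoint_fun (psi : dual F) : dual E :=
  Operator (adjoint_fun_subproof psi).

Lemma adjoint_subproof : adjoint_fun \in @bounded_linear _ _ (dual F) (dual E).
Proof.
apply/bounded_linearP; split.
  by move=> a phi psi; apply/val_inj/funext.
exists (operator_norm T); first exact: operator_norm_ge0.
move=> psi; rewrite !rnorm_operator.
apply: operator_norm_le; first by rewrite mulr_ge0 ?operator_norm_ge0.
move=> x /=; rewrite (le_trans (operator_norm_ub psi _))//.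
by rewrite [operator_norm T * _]mulrC -mulrA ler_wpM2l ?operator_norm_ge0
  ?operator_norm_ub.
Qed.

Definition adjoint : operator (dual F) (dual E) := Operator adjoint_subproof.

End Adjoint.
End Duality.

Section Linfty.
Context {d : measure_display} {Omega : measurableType d} {R : realType}.
Variables (k : scalar_kind) (mu : {measure set Omega -> \bar R}).
Local Notation K := (scalars R k).
Implicit Types f g : Omega -> K^o.

(* Over the reals the second condition is trivial. *)
Definition scalar_measurable f :=
  measurable_fun setT (re_part \o f) /\ measurable_fun setT (im_part \o f).

(* [Lnorm] at +oo is the essential supremum, or 0 if mu is the zero measure. *)
Definition Linf_norm f : \bar R := Lnorm mu +oo%E (fun x => (rnorm (f x))%:E).

Definition Linf_fun_pred : {pred Omega -> K^o} :=
  mem [set f | scalar_measurable f /\ (Linf_norm f < +oo)%E].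

Record Linf_fun := LinfFun {
  Linf_fun_val :> Omega -> K^o;
  Linf_funP : Linf_fun_val \in Linf_fun_pred
}.

HB.instance Definition _ := [isSub for Linf_fun_val].
HB.instance Definition _ := [Choice of Linf_fun by <:].

Lemma Linf_normE f : Linf_norm f =
  if (0 < mu setT)%E then ess_sup mu (fun x => (rnorm (f x))%:E) else 0%E.
Proof.
rewrite /Linf_norm unlock; case: ifP => // _.
by apply: eq_ess_sup; apply/nearW => x /=; rewrite ger0_norm// rnorm_ge0.
Qed.

Lemma Linf_norm_ge0 f : (0 <= Linf_norm f)%E.
Proof. exact: Lnorm_ge0. Qed.

Lemma eq_Linf_norm f g : f = g %[ae mu] -> Linf_norm f = Linf_norm g.
Proof.
move=> fg; rewrite !Linf_normE; case: ifP => // _; apply: eq_ess_sup.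
by apply: filterS fg => x /= ->.
Qed.

Lemma Linf_normD f g : (Linf_norm (f \+ g)%R <= Linf_norm f + Linf_norm g)%E.
Proof.
rewrite !Linf_normE; case: ifP => [_|]; last by rewrite adde0.
pose nf x := (rnorm (f x))%:E; pose ng x := (rnorm (g x))%:E.
apply: le_trans (ess_supD mu nf ng); apply: le_ess_sup; apply/nearW => x /=.
by rewrite lee_fin ler_rnormD.
Qed.

Lemma Linf_normZ (a : K) f :
  Linf_norm (a \*: f) = ((rnorm (a : K^o))%:E * Linf_norm f)%E.
Proof.
rewrite !Linf_normE; case: ifP => [mu0|]; last by rewrite mule0.
rewrite -ess_supZl ?rnorm_ge0//; apply: eq_ess_sup; apply/nearW => x /=.
by rewrite rnormZ EFinM.
Qed.

Lemma Linf_norm_eq0 f : Linf_norm f = 0%E -> f = 0 %[ae mu].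
Proof.
rewrite Linf_normE; case: ifPn => [mu0 f0|].
  have /ess_supP : (ess_sup mu (fun x => (rnorm (f x))%:E) <= 0)%E by rewrite f0.
  apply: filterS => x + _; rewrite lee_fin => fx0.
  by apply: rnorm_eq0; apply/le_anti; rewrite fx0 rnorm_ge0.
by rewrite -leNgt measure_le0 => /eqP mu0 _; exact: ae_eq0.
Qed.

Lemma Linf_fun_submod_closed : submod_closed Linf_fun_pred.
Proof.
split.
  rewrite inE /=; split.
    by split; [rewrite (_ : _ \o _ = cst (re_part (0 : K)))
      | rewrite (_ : _ \o _ = cst (im_part (0 : K)))].
  rewrite Linf_normE; case: ifP => // _.
  rewrite (@le_lt_trans _ _ 0%E)//; apply/ess_supP/nearW => x /=.
  by rewrite rnorm0.
move=> a f g; rewrite !inE /= => -[[rf jf] nf] [[rg jg] ng]; split; last first.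
  rewrite (le_lt_trans (Linf_normD (a \*: f) g))// lte_add_pinfty// Linf_normZ.
  by rewrite lte_mul_pinfty// lee_fin rnorm_ge0.
split.
  rewrite (_ : _ \o _ = (fun x => re_part a * re_part (f x)
     - im_part a * im_part (f x) + re_part (g x))); last first.
    by apply/funext => x /=; rewrite re_partD re_partM.
  apply: measurable_funD => //; apply: measurable_funB;
    by apply: measurable_funM => //; exact: measurable_cst.
rewrite (_ : _ \o _ = (fun x => re_part a * im_part (f x)
   + im_part a * re_part (f x) + im_part (g x))); last first.
  by apply/funext => x /=; rewrite im_partD im_partM.
apply: measurable_funD => //; apply: measurable_funD;
  by apply: measurable_funM => //; exact: measurable_cst.
Qed.

HB.instance Definition _ := GRing.isSubmodClosed.Build _ _ Linf_fun_pred
  Linf_fun_submod_closed.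
HB.instance Definition _ := [SubChoice_isSubLmodule of Linf_fun by <:].

Definition ae_null : {pred Linf_fun} :=
  mem [set f : Linf_fun | (f : Omega -> K^o) = 0 %[ae mu]].

Lemma ae_null_zmod_closed : zmod_closed ae_null.
Proof.
split; first by rewrite inE /=; exact: ae_eq_refl.
move=> f g; rewrite !inE /= => f0 g0.
apply: filterS2 f0 g0 => x /= f0 g0 _.
by rewrite [LHS]/(f x - g x) f0// g0//; exact: subr0.
Qed.

HB.instance Definition _ := GRing.isZmodClosed.Build _ ae_null
  ae_null_zmod_closed.

Definition Linf : Type := Quotient.quot ae_null.

HB.instance Definition _ := GRing.Zmodule.on Linf.

Local Notation class := (\pi_(Quotient.quot ae_null)%qT : Linf_fun -> Linf).

Definition Linf_repr (u : Linf) : Linf_fun := repr u.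
(* A representative of u, only determined almost everywhere. *)
Definition Linf_val (u : Linf) : Omega -> K^o := Linf_repr u.

Lemma Linf_reprK u : class (Linf_repr u) = u.
Proof. exact: reprK. Qed.

Lemma Linf_classP (f g : Linf_fun) :
  class f = class g <-> (f : Omega -> K^o) = g %[ae mu].
Proof.
rewrite (rwP (@eqP _ (class f) _)) -Quotient.idealrBE inE /=; split => fg.
  by apply: filterS fg => x /= fg _; apply/eqP; rewrite -subr_eq0; exact/eqP/fg.
by apply: filterS fg => x /= fg _; rewrite [LHS]/(f x - g x) fg//; exact: subrr.
Qed.

Lemma Linf_reprE (f : Linf_fun) : Linf_val (class f) = f %[ae mu].
Proof. by apply/Linf_classP; rewrite Linf_reprK. Qed.

Lemma classD (f g : Linf_fun) : class (f + g) = class f + class g.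
Proof. exact: Quotient.pi_add. Qed.

Lemma class0 : class 0 = 0.
Proof. by apply: (@addrI _ (class 0)); rewrite -classD !addr0. Qed.

Definition Linf_scale (a : K) (u : Linf) : Linf := class (a *: Linf_repr u).

Lemma Linf_scale_class a (f : Linf_fun) : Linf_scale a (class f) = class (a *: f).
Proof.
apply/Linf_classP; have := Linf_reprE f.
by apply: filterS => x /= fx _; congr (_ *: _); exact: fx.
Qed.

Fact Linf_scaleA a b u : Linf_scale a (Linf_scale b u) = Linf_scale (a * b) u.
Proof. by rewrite -(Linf_reprK u) !Linf_scale_class scalerA. Qed.

Fact Linf_scale1 : left_id 1 Linf_scale.
Proof. by move=> u; rewrite -(Linf_reprK u) Linf_scale_class scale1r. Qed.

Fact Linf_scaleDr : right_distributive Linf_scale +%R.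
Proof.
move=> a u v; rewrite -(Linf_reprK u) -(Linf_reprK v) !Linf_scale_class.
by rewrite -!classD Linf_scale_class scalerDr.
Qed.

Fact Linf_scaleDl u : {morph Linf_scale^~ u : a b / a + b}.
Proof.
move=> a b; rewrite -(Linf_reprK u) !Linf_scale_class.
by rewrite -classD scalerDl.
Qed.

HB.instance Definition _ := GRing.Zmodule_isLmodule.Build K Linf
  Linf_scaleA Linf_scale1 Linf_scaleDr Linf_scaleDl.

Lemma Linf_val_add (u v : Linf) :
  Linf_val (u + v) = Linf_val u \+ Linf_val v %[ae mu].
Proof.
have -> : u + v = class (Linf_repr u + Linf_repr v).
  by rewrite classD !Linf_reprK.
exact: Linf_reprE.
Qed.

Lemma Linf_val_scale (a : K) (u : Linf) :
  Linf_val (a *: u) = a \*: Linf_val u %[ae mu].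
Proof. exact: Linf_reprE. Qed.

Lemma Linf_val_inj (u v : Linf) : Linf_val u = Linf_val v %[ae mu] -> u = v.
Proof. by move=> /Linf_classP; rewrite !Linf_reprK. Qed.

Let nrm (u : Linf) : K := of_real (fine (Linf_norm (Linf_val u))).

Lemma Linf_norm_fin (u : Linf) : Linf_norm (Linf_val u) \is a fin_num.
Proof.
rewrite ge0_fin_numE ?Linf_norm_ge0//.
by have := Linf_funP (Linf_repr u); rewrite inE => -[].
Qed.

Fact Linf_ler_normD u v : nrm (u + v) <= nrm u + nrm v.
Proof.
rewrite -of_realD ler_of_real -fineD ?Linf_norm_fin//.
rewrite (eq_Linf_norm (Linf_val_add u v)) fine_le//.
- by rewrite -(eq_Linf_norm (Linf_val_add u v)) Linf_norm_fin.
- by rewrite fin_numD !Linf_norm_fin.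
- exact: Linf_normD.
Qed.

Fact Linf_normrZ a u : nrm (a *: u) = `|a| * nrm u.
Proof.
rewrite -(of_real_rnorm (a : K^o)) -of_realM; congr of_real.
by rewrite (eq_Linf_norm (Linf_val_scale a u)) Linf_normZ fineM ?Linf_norm_fin.
Qed.

Fact Linf_normr0_eq0 u : nrm u = 0 -> u = 0.
Proof.
rewrite -(of_real0 R k) => /(can_inj (@of_realK R k)) u0.
have uz : Linf_val u = 0 %[ae mu].
  apply: Linf_norm_eq0.
  by rewrite -[LHS]fineK ?Linf_norm_fin// u0.
by rewrite -class0 -(Linf_reprK u); apply/Linf_classP.
Qed.

HB.instance Definition _ := @Lmodule_isNormed.Build K Linf
  nrm Linf_ler_normD Linf_normrZ Linf_normr0_eq0.

Lemma rnorm_Linf (u : Linf) : rnorm u = fine (Linf_norm (Linf_val u)).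
Proof. exact: of_realK. Qed.

End Linfty.

(* Ordinals are represented by trees, where [osup i0 f] is the supremum of the
   family f, indexed by a type inhabited by i0; this supremum may be attained.
   An ordinal has many representing trees: [ole] is a total preorder, whose
   strict part [olt] is well-founded, and a and b represent the same ordinal
   when [ole a b] and [ole b a]. *)
Inductive ord : Type :=
  | ozero
  | osucc of ord
  | osup (I : Type) of I & (I -> ord).

Fixpoint ole (a : ord) : ord -> Prop :=
  match a with
  | ozero => fun=> True
  | osucc a' => fix succ_le (b : ord) : Prop :=
      match b with
      | ozero => False
      | osucc b' => ole a' b'
      | osup J _ g => exists i : J, succ_le (g i)
      end
  | osup J _ f => fun b => forall i : J, ole (f i) b
  end.

(* a < b is a + 1 <= b; [succ_le] above is b |-> a' < b. *)
Definition olt (a b : ord) : Prop := ole (osucc a) b.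

Definition olimit (a : ord) : Prop :=
  olt ozero a /\ forall b, olt b a -> olt (osucc b) a.

Definition ocountable (a : ord) : Prop :=
  exists g : nat -> ord, forall b, olt b a -> exists n, ole b (g n) /\ ole (g n) b.

Lemma ole_sup (I : Type) (i0 : I) (f : I -> ord) a i :
  ole a (f i) -> ole a (osup i0 f).
Proof. by elim: a => //= [a _ ai|J j0 g IH ai j]; [exists i|exact/IH/ai]. Qed.

Lemma oltW a b : olt a b -> ole a b.
Proof.
elim: a b => [//|a IHa|I i0 f IH] b.
  elim: b => [//|b _|J j0 g IHb]; first exact: IHa.
  by case=> j /IHb ?; exists j.
move=> ab i; apply: IH.
elim: b ab => [//|b _ ab|J j0 g IHb [j /IHb ?]]; [exact: ab|by exists j].
Qed.

Lemma ole_refl a : ole a a.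
Proof. by elim: a => //= I i0 f IH i; apply: (@ole_sup _ _ _ _ i). Qed.

Lemma ole_trans b a c : ole a b -> ole b c -> ole a c.
Proof.
elim: a b c => [//|a IHa|I i0 f IH] b c; last by move=> ab bc i; apply: IH bc.
elim: b c => [//|b _|J j0 g IHb] c /=.
  move=> ab; elim: c => [//|c _|J j0 h IHc] /=; first exact: IHa.
  by case=> j /IHc ?; exists j.
by case=> j /IHb aj gc; exact: aj (gc j).
Qed.

Lemma ole_lt_total a b : (ole a b \/ olt b a) /\ (ole b a \/ olt a b).
Proof.
elim: a b => [|a IHa|I i0 f IH] b.
- split; first by left.
  elim: b => [|b _|J j0 g IHb]; [by left|by right|].
  have [[j gj]|gN] := EM (exists j, olt ozero (g j)); first by right; exists j.
  by left=> j; have [//|gj] := IHb j; case: gN; exists j.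
- have le b' : ole (osucc a) b' \/ olt b' (osucc a).
    by have [_ [?|?]] := IHa b'; [right|left].
  split; first exact: le.
  elim: b => [|b _|J j0 g IHb]; [by left| |].
    by have [?|?] := le b; [right|left].
  have [[j gj]|gN] := EM (exists j, olt (osucc a) (g j)); first by right; exists j.
  by left=> j; have [//|gj] := IHb j; case: gN; exists j.
- have le b' : ole (osup i0 f) b' \/ olt b' (osup i0 f).
    have [[j gj]|gN] := EM (exists j, olt b' (f j)); first by right; exists j.
    by left=> j; have [[//|gj] _] := IH j b'; case: gN; exists j.
  split; first exact: le.
  elim: b => [|b _|J j0 g IHb]; [by left| |].
    by have [?|?] := le b; [right|left].
  have [[j gj]|gN] := EM (exists j, olt (osup i0 f) (g j)).
    by right; exists j.
  by left=> j; have [//|gj] := IHb j; case: gN; exists j.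
Qed.

Lemma ole_total a b : ole a b \/ olt b a.
Proof. by have [] := ole_lt_total a b. Qed.

Lemma olt_wf : well_founded olt.
Proof.
move=> a; suff: forall b, ole b a -> Acc olt b by apply; exact: ole_refl.
elim: a => [|a IHa|I i0 f IH] b ba; constructor=> c cb;
  have ca := ole_trans cb ba.
- by case: ca.
- exact: IHa.
- by case: ca => i /oltW; exact: IH.
Qed.

Lemma olt_irrefl a : ~ olt a a.
Proof. by elim/(well_founded_ind olt_wf): a => a IH aa; exact: (IH _ aa aa). Qed.

(* Every well-founded relation on a choiceType, in particular on a Banach
   space, has a rank in [ord]. This also fixes the universe levels: the index
   types of [osup] range over a universe containing all these carriers. *)
Fixpoint wf_rank (T : choiceType) (r : T -> T -> Prop) (x : T) (h : Acc r x) : ord :=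
  osup None (fun o : option {y | r y x} =>
    if o is Some y then osucc (wf_rank (Acc_inv h (proj2_sig y))) else ozero).

Lemma wf_rank_lt (T : choiceType) (r : T -> T -> Prop) (x y : T) (h : Acc r x)
  (ryx : r y x) : olt (wf_rank (Acc_inv h ryx)) (wf_rank h).
Proof.
by case: h => h /=; exists (Some (exist _ y ryx)); exact: ole_refl.
Qed.

Fixpoint oadd (a b : ord) : ord :=
  match b with
  | ozero => a
  | osucc b' => osucc (oadd a b')
  | osup J i0 f => osup i0 (fun i : J => oadd a (f i))
  end.

Fixpoint omul (a b : ord) : ord :=
  match b with
  | ozero => ozero
  | osucc b' => oadd (omul a b') a
  | osup J i0 f => osup i0 (fun i => omul a (f i))
  end.

Definition omega : ord := osup 0%N (fun n => iter n osucc ozero).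

(* omega ^ a *)
Fixpoint omega_pow (a : ord) : ord :=
  match a with
  | ozero => osucc ozero
  | osucc a' => omul (omega_pow a') omega
  | osup J i0 f => osup i0 (fun i => omega_pow (f i))
  end.

Inductive countable_tree : Set :=
  | ctzero
  | ctsucc of countable_tree
  | ctsup of (nat -> countable_tree).

Fixpoint ord_of_tree (t : countable_tree) : ord :=
  match t with
  | ctzero => ozero
  | ctsucc t' => osucc (ord_of_tree t')
  | ctsup f => osup 0%N (fun n => ord_of_tree (f n))
  end.

(* Each tree denotes a countable ordinal, and each countable ordinal is
   denoted by a tree, hence their supremum is the first uncountable ordinal:
   see [omega1P]. *)
Definition omega1 : ord := osup ctzero ord_of_tree.

Lemma omega1P a : olt a omega1 <-> ocountable a.
Proof.
split=> [[t]|].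
  suff: ocountable (ord_of_tree t).
    move=> [g gP] at_; exists g => b ba; apply: gP.
    exact: (ole_trans ba (oltW at_)).
  elim: t {a} => [|t [g gP]|f IH] /=.
  - by exists (fun=> ozero).
  - exists (fun n => if n is m.+1 then g m else ord_of_tree t) => b bt.
    have [tb|bt'] := ole_total (ord_of_tree t) b; first by exists 0%N.
    by have [n ?] := gP _ bt'; exists n.+1.
  - have [g gP] := choice IH.
    exists (fun n => if unpickle n is Some (m, p) then g m p else ozero).
    by move=> b [m /gP[p ?]]; exists (pickle (m, p)); rewrite pickleK.
elim/(well_founded_ind olt_wf): a => a IH [g gP].
have gT n : exists t, olt (g n) a -> ole (g n) (ord_of_tree t).
  have [gna|?] := EM (olt (g n) a); last by exists ctzero.
  have [t gt] : olt (g n) omega1.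
    apply: (IH _ gna); exists g => b bg; apply: gP; exact: (ole_trans bg (oltW gna)).
  by exists t => _; exact: oltW gt.
have {gT}[f fP] := choice gT.
exists (ctsucc (ctsup (fun n => ctsucc (f n)))) => /=.
have [//|fa] := ole_total a (osup 0%N (fun n => osucc (ord_of_tree (f n)))).
have [n [bg gb]] := gP _ fa.
have /fP gnf : olt (g n) a by apply: ole_trans fa; exact: gb.
have := ole_trans bg gnf => /(_ n) /=.
by move/olt_irrefl.
Qed.

Section Szlenk.
Variables (R : realType) (k : scalar_kind).
Local Notation K := (scalars R k).

Section Derivations.
Variable E : normedModType K.
Implicit Types (A : set (dual E)) (eps : R).

Definition norm_diam A : \bar R :=
  ereal_sup [set (rnorm (p.1 - p.2))%:E | p in A `*` A].

Definition szlenk_derivative eps A : set (dual E) :=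
  [set x | A x /\ forall V : set (weak_star E),
    open V -> V x -> (eps%:E < norm_diam (A `&` V))%E].

(* Since the derivatives decrease, taking the intersection at every supremum,
   attained or not, agrees with the usual definition: see [szlenk_iter_anti] and
   [szlenk_iter_limit]. *)
Fixpoint szlenk_iter eps A (a : ord) : set (dual E) :=
  match a with
  | ozero => A
  | osucc b => szlenk_derivative eps (szlenk_iter eps A b)
  | osup J _ f => [set x | forall i : J, szlenk_iter eps A (f i) x]
  end.

(* Szlenk indices are classes of ordinals, that is, predicates on [ord]; the
   class of all ordinals plays the role of infinity. *)
Definition Sz_eps eps A (a : ord) : Prop := szlenk_iter eps A a !=set0.

Definition Sz A (a : ord) : Prop := exists2 eps : R, 0 < eps & Sz_eps eps A a.

Lemma szlenk_derivativeS eps A B : A `<=` B ->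
  szlenk_derivative eps A `<=` szlenk_derivative eps B.
Proof.
move=> AB x [Ax xA]; split=> [|V oV Vx]; first exact: AB.
apply: lt_le_trans (xA V oV Vx) _; apply: ereal_sup_le; apply: image_subset.
by move=> [y z] [[/AB ? ?] [/AB ? ?]].
Qed.

Lemma szlenk_iter_anti eps A a b :
  ole a b -> szlenk_iter eps A b `<=` szlenk_iter eps A a.
Proof.
elim: a b => [|a IHa|J i0 f IH] b /=.
- move=> _; elim: b => [//|b IH x [/IH]//|J i0 f IH x /= xf].
  exact: (IH i0).
- elim: b => [//|b _ ab|J j0 g IH [j /IH jg] x gx]; last exact: jg.
  exact/szlenk_derivativeS/IHa.
- by move=> fb x bx i; exact: IH (fb i) _ bx.
Qed.

Lemma szlenk_iter_limit eps A a : olimit a ->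
  szlenk_iter eps A a = [set x | forall b, olt b a -> szlenk_iter eps A b x].
Proof.
move=> la; apply/seteqP; split=> [x ax b /oltW ba|x].
  exact: szlenk_iter_anti ba _ ax.
elim: a la => [[]//|a _ [_ la] _|J i0 f IH [l0 lf] fx i].
  by have /olt_irrefl := la a (ole_refl a).
have [fi|fi] := ole_total (osup i0 f) (f i); last exact: fx.
have sfi b : olt b (osup i0 f) <-> olt b (f i).
  by split=> [bf|]; [exact: ole_trans bf fi|exists i].
apply: IH => [|b /sfi]; last exact: fx.
by split=> [|b /sfi /lf /sfi]; first exact/sfi.
Qed.

End Derivations.

Definition separable_set (V : normedModType K) (A : set V) : Prop :=
  exists2 D : set V, countable D & D `<=` A /\ A `<=` closure D.

Section OperatorClasses.
Variables E F : normedModType K.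

Definition separable_range : set (operator E F) :=
  [set T : operator E F | separable_set (range T)].

Definition Sz_op (T : operator E F) : ord -> Prop :=
  Sz (adjoint T @` closed_unit_ball (dual F)).

(* Sz T <= omega ^ a, as an inclusion between classes of ordinals. *)
Definition SZ (a : ord) : set (operator E F) :=
  [set T : operator E F | forall b, Sz_op T b -> olt b (omega_pow a)].

Definition asplund : set (operator E F) :=
  [set T : operator E F | forall (d : measure_display) (Omega : measurableType d)
      (mu : {finite_measure set Omega -> \bar R})
      (S : operator F (Linf k mu)) (eps : R), 0 < eps ->
    exists B : set Omega,
      [/\ measurable B, (mu setT - eps%:E < mu B)%E &
          precompact [set g : Linf k mu |
            exists2 f, ((S \o T) @` closed_unit_ball E) f &
              Linf_val g = (fun w => Linf_val f w * \1_B w) %[ae mu]]]].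

End OperatorClasses.

Definition dual_range_separable (E F : normedModType K) : set (operator E F) :=
  [set T : operator E F | separable_range (adjoint T)].

End Szlenk.
Arguments separable_range {R k} E F _.
Arguments dual_range_separable {R k} E F _.
Arguments asplund {R k} E F _.
Arguments SZ {R k E F} a _.

(* Main.v *)
(* Let K := T^* B_{F^*} and suppose that T has separable range, so that the weak*
   topology of K has a countable base. If s_eps^a(K) is empty for some a, for each
   eps > 0, then K is a countable union of sets of diameter at most eps, hence
   separable. If no nonempty L in K satisfies L = s_eps(L), the derivatives of K
   decrease strictly until they vanish, at a countable stage.
   If T^* has separable range, then almost everywhere S T x is the evaluation at x
   of a point of a separable subset of E^*; a Lusin-type argument yields a set B of
   almost full measure on which these points form a totally bounded set.
   Finally, a nonempty L = s_eps(L) carries a dyadic tree of slices, whose limit is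
   an operator S : F -> L_oo[0, 1[ violating the Asplund property. *)

Require Import Defs.
From HB Require Import structures.
From mathcomp Require Import all_boot all_order all_algebra.
From mathcomp Require Import ring lra complex.
From mathcomp Require Import all_classical all_reals all_analysis.
From mathcomp Require Import measurable_realfun ess_sup_inf.

Set Implicit Arguments.
Unset Strict Implicit.
Unset Printing Implicit Defensive.
Import Order.TTheory GRing.Theory Num.Theory.
Import numFieldNormedType.Exports.

Local Open Scope classical_set_scope.
Local Open Scope ring_scope.

(** The four equalities follow from a single cycle of implications; a bound a on the Szlenk index
    yields membership in [SZ a] because a <= omega^a. An element of L_oo has values only almost
    everywhere, so for fixed w the map T x |-> (S T x)(w) is not a linear functional before
    uncountably many null sets are dealt with. Separability of the range of T leaves countably many
    inequalities, on a dense sequence and with scalars from a countable dense set; off one null set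
    they allow a Hahn-Banach extension to all of F. The null sets that still depend on x do no harm,
    because total boundedness in L_oo compares two functions at a time. The final contradiction is
    quantitative: sibling slices are e / 2 apart, whereas a finite e / 8 net and a set on which the
    net oscillates by at most e / 8 allow a variation of 3 e / 8. Lebesgue measure is used because
    it has no atoms: a set of positive measure contains two points, and these are separated at some
    dyadic level. *)

(** * Real and complex scalars in one notation *)

Section ScalarTools.
Variables (R : realType) (k : scalar_kind).
Local Notation K := (scalars R k).
Implicit Types (z w : K) (V : normedModType K).

(** Over the reals the second argument is dropped; this is why [im_part] of the result is only
    bounded, in [im_of_parts_bound], and not computed. *)
Definition of_parts : R -> R -> K :=
  match k return R -> R -> scalars R k with
  | RealScalars => fun a _ => a
  | ComplexScalars => fun a b => Complex a b
  end.

Lemma of_partsK z : of_parts (re_part z) (im_part z) = z.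
Proof. by rewrite /of_parts; case: k z => //= -[]. Qed.

Lemma re_of_parts a b : re_part (of_parts a b) = a.
Proof. by rewrite /of_parts; case: k. Qed.

Lemma re_of_real (t : R) : re_part (of_real t : K) = t.
Proof. exact: of_realK. Qed.

Lemma im_of_real (t : R) : im_part (of_real t : K) = 0.
Proof. by case: k. Qed.

Lemma of_parts_linear (a : K) (x y x' y' : R) :
  a * of_parts x y + of_parts x' y'
  = of_parts (re_part a * x - im_part a * y + x') (re_part a * y + im_part a * x + y').
Proof.
rewrite /of_parts; case: k a => /= [a|[a b] //].
by rewrite mul0r subr0.
Qed.

Lemma im_of_parts_bound a b : `|im_part (of_parts a b)| <= `|b|.
Proof. by rewrite /of_parts; case: k => //=; rewrite normr0. Qed.

Lemma scalar_ext z w : re_part z = re_part w -> im_part z = im_part w -> z = w.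
Proof. by move=> rzw izw; rewrite -(of_partsK z) rzw izw of_partsK. Qed.

Lemma re_partN z : re_part (- z) = - re_part z.
Proof. by case: k z => //= -[]. Qed.

Lemma im_partN z : im_part (- z) = - im_part z.
Proof. by case: k z => /= [z|[]//]; rewrite oppr0. Qed.

Lemma re_partB z w : re_part (z - w) = re_part z - re_part w.
Proof. by rewrite re_partD re_partN. Qed.

Lemma im_partB z w : im_part (z - w) = im_part z - im_part w.
Proof. by rewrite im_partD im_partN. Qed.

Lemma rnorm_scalarE z :
  rnorm (z : K^o) = Num.sqrt (re_part z ^+ 2 + im_part z ^+ 2).
Proof.
rewrite /rnorm; case: k z => [z|[a b]] /=; last by [].
by rewrite expr0n addr0 sqrtr_sqr.
Qed.

Lemma re_part_le z : `|re_part z| <= rnorm (z : K^o).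
Proof. by rewrite rnorm_scalarE -sqrtr_sqr ler_wsqrtr// lerDl sqr_ge0. Qed.

Lemma im_part_le z : `|im_part z| <= rnorm (z : K^o).
Proof. by rewrite rnorm_scalarE -sqrtr_sqr ler_wsqrtr// lerDr sqr_ge0. Qed.

Lemma rnorm_le_parts z : rnorm (z : K^o) <= `|re_part z| + `|im_part z|.
Proof.
rewrite rnorm_scalarE -[leRHS]ger0_norm ?addr_ge0// -sqrtr_sqr ler_wsqrtr//.
rewrite sqrrD !real_normK ?num_real// -addrA lerD2l lerDr mulrn_wge0// mulr_ge0//.
Qed.

Lemma rnorm_of_real (t : R) : rnorm (of_real t : K^o) = `|t|.
Proof. by rewrite rnorm_scalarE re_of_real im_of_real expr0n addr0 sqrtr_sqr. Qed.

Lemma rnormM z w : rnorm (z * w : K^o) = rnorm (z : K^o) * rnorm (w : K^o).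
Proof. exact: (@rnormZ _ _ K^o). Qed.

Lemma rnormN V (x : V) : rnorm (- x) = rnorm x.
Proof. by rewrite /rnorm normrN. Qed.

Lemma rnormB V (x y : V) : rnorm (x - y) = rnorm (y - x).
Proof. by rewrite -rnormN opprB. Qed.

Lemma rnorm_triangle V (y x z : V) : rnorm (x - z) <= rnorm (x - y) + rnorm (y - z).
Proof. by rewrite -[x - z](subrKA y) ler_rnormD. Qed.

Lemma rnorm_neq0 V (x : V) : x != 0 -> 0 < rnorm x.
Proof.
by move=> x0; rewrite lt_neqAle rnorm_ge0 andbT eq_sym; apply: contra_neq x0 => /rnorm_eq0.
Qed.

(** Multiplication by a unimodular scalar turns estimates of real parts into estimates of moduli. *)
Lemma rotation z : exists2 a : K,
  rnorm (a : K^o) = 1 & a * z = of_real (rnorm (z : K^o)).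
Proof.
have [->|z0] := eqVneq z 0.
  exists 1; first by rewrite -(of_real1 R k) rnorm_of_real normr1.
  by rewrite mulr0 rnorm0 of_real0.
have z0' := rnorm_neq0 (z0 : (z : K^o) != 0).
exists (of_real (rnorm (z : K^o)) / z); last by rewrite mulfVK.
apply: (@mulIf _ (rnorm (z : K^o))); first by rewrite gt_eqF.
by rewrite -rnormM mulfVK// rnorm_of_real mul1r ger0_norm// ltW.
Qed.

Lemma rnormZreal V (t : R) (x : V) : rnorm (of_real t *: x) = `|t| * rnorm x.
Proof. by rewrite (rnormZ (of_real t : K^o)) rnorm_of_real. Qed.

Lemma of_realN (t : R) : of_real (- t) = - of_real t :> K.
Proof. by case: k => //=; exact: (rmorphN (real_complex R)). Qed.

Lemma scaler_of_realN1 V (x : V) : of_real (-1) *: x = - x.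
Proof. by rewrite of_realN of_real1 scaleN1r. Qed.

End ScalarTools.
Arguments of_parts {R k} _ _.
Arguments rotation {R k} z.
Arguments rnorm_triangle {R k V} y x z.

(** * Hahn-Banach for partial functionals given by their graphs *)

Section HahnBanach.
Variables (R : realType) (k : scalar_kind).
Local Notation K := (scalars R k).
Variables (V : normedModType K) (C : R).
Hypothesis C0 : 0 <= C.

(** Single-valuedness follows from domination: the difference of two values at the same point is a
    value at 0, hence at most 0. *)
Definition dominated_graph (G : set (V * R)) : Prop :=
  (forall (t : R) p q, G p -> G q ->
     G (of_real t *: p.1 + q.1, t * p.2 + q.2))
  /\ (forall p, G p -> p.2 <= C * rnorm p.1).

(** The value at x0 has to lie above every p.2 - C |p.1 - x0| and below every C |p.1 + x0| - p.2.
    The triangle inequality makes these constraints compatible, and the supremum of the lower ones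
    is taken. *)
Lemma dominated_graph_step (H : set (V * R)) (x0 : V) : H !=set0 ->
  dominated_graph H ->
  exists2 H' : set (V * R), H `<=` H' /\ dominated_graph H' &
    exists c, H' (x0, c).
Proof.
move=> [h0 Hh0] [Hl HC].
have H00 : H (0, 0).
  have := Hl (-1) _ _ Hh0 Hh0; rewrite scaler_of_realN1 mulN1r.
  by rewrite !addNr.
pose A := [set p.2 - C * rnorm (p.1 - x0) | p in H].
have Aub p : H p -> ubound A (C * rnorm (p.1 + x0) - p.2).
  move=> Hp _ [q Hq <-].
  have := HC _ (Hl 1 _ _ Hp Hq); rewrite /= of_real1 scale1r mul1r => h.
  rewrite lerBrDr addrAC lerBlDr [q.2 + _]addrC (le_trans h)// -mulrDr ler_wpM2l//.
  by rewrite (le_trans _ (ler_rnormD _ _))// addrACA subrr addr0.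
have A0 : A !=set0 by exists ((0 : R) - C * rnorm (0 - x0)), (0, 0).
have supA : has_sup A by split=> //; exists (C * rnorm (0 + x0) - 0); exact: Aub H00.
pose c0 := sup A.
have lo p : H p -> p.2 - C * rnorm (p.1 - x0) <= c0.
  by move=> Hp; apply: ub_le_sup; [exact: supA.2|exists p].
have hi p : H p -> c0 <= C * rnorm (p.1 + x0) - p.2.
  by move=> Hp; apply: ge_sup => //; exact: Aub.
have key p t : H p -> p.2 + t * c0 <= C * rnorm (p.1 + of_real t *: x0).
  (* Division by |t| reduces the claim to [hi] when t > 0 and to [lo] when t < 0. *)
  move=> Hp; have [t0|t0|->] := ltgtP t 0; last first.
  - by rewrite mul0r addr0 of_real0 scale0r addr0 HC.
  - have nt (y : V) : rnorm (of_real t *: y) = t * rnorm y by rewrite rnormZreal gtr0_norm.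
    have := hi _ (Hl t^-1 _ _ Hp H00); rewrite /= !addr0.
    rewrite -(ler_pM2l t0) mulrBr !mulrA mulfV ?gt_eqF// mul1r.
    rewrite lerBrDr addrC => /le_trans; apply.
    rewrite [t * C]mulrC -mulrA -nt scalerDr scalerA.
    by rewrite -of_realM mulfV ?gt_eqF// of_real1 scale1r.
  - pose s := - t; have s0 : 0 < s by rewrite oppr_gt0.
    have ns (y : V) : rnorm (of_real s *: y) = s * rnorm y by rewrite rnormZreal gtr0_norm.
    have := lo _ (Hl s^-1 _ _ Hp H00); rewrite /= !addr0.
    rewrite -(ler_pM2l s0) mulrBr !mulrA mulfV ?gt_eqF// mul1r.
    rewrite lerBlDr -lerBlDl => h.
    rewrite -[t]opprK mulNr (le_trans h)//.
    rewrite [s * C]mulrC -mulrA -ns scalerBr scalerA.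
    rewrite -of_realM mulfV ?gt_eqF// of_real1 scale1r.
    by rewrite [in leRHS]of_realN scaleNr.
exists [set q | exists2 p, H p & exists t, q = (p.1 + of_real t *: x0, p.2 + t * c0)].
  split; first by move=> p Hp; exists p => //; exists 0; rewrite of_real0 scale0r mul0r !addr0; case: p Hp.
  split.
    move=> t _ _ [p Hp [a ->]] [q Hq [b ->]] /=.
    exists (of_real t *: p.1 + q.1, t * p.2 + q.2); first exact: Hl.
    exists (t * a + b) => /=; congr pair.
      by rewrite scalerDr scalerA of_realD of_realM scalerDl addrACA.
    by ring.
  by move=> _ [p Hp [t ->]] /=; exact: key.
by exists c0, (0, 0) => //; exists 1; rewrite of_real1 scale1r mul1r !add0r.
Qed.

Lemma real_hahn_banach (G : set (V * R)) : G !=set0 -> dominated_graph G ->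
  exists u : V -> R,
    [/\ forall t x y, u (of_real t *: x + y) = t * u x + u y,
        forall x, u x <= C * rnorm x & forall p, G p -> u p.1 = p.2].
Proof.
move=> [g0 Gg0] Ggood.
(* Zorn's lemma is applied to all chains, including the empty one, whose union is empty; adding G to
   each A keeps that case valid. *)
pose P (A : set (V * R)) := dominated_graph (A `|` G).
have [|A [PA maxA]] := @Zorn_bigcup _ P.
  move=> F FP Ftot; split=> [t p q|p [[X FX Xp]|Gp]]; last 2 first.
  - by apply: (FP X FX).2; left.
  - exact: Ggood.2.
  have inX X : F X -> X `<=` \bigcup_(Y in F) Y by move=> FX x Xx; exists X.
  have get X p' q' : F X -> (X `|` G) p' -> (X `|` G) q' ->
    (\bigcup_(Y in F) Y `|` G) (of_real t *: p'.1 + q'.1, t * p'.2 + q'.2).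
    move=> FX Xp Xq; have [|] := (FP X FX).1 t _ _ Xp Xq; last by right.
    by move=> h; left; exact: inX h.
  move=> [[X FX Xp]|Gp] [[Y FY Yq]|Gq].
  - have [XY|YX] := Ftot _ _ FX FY.
      by apply: (get Y) => //; left => //; exact: XY.
    by apply: (get X) => //; left => //; exact: YX.
  - by apply: (get X) => //; [left|right].
  - by apply: (get Y) => //; [right|left].
  - by right; exact: Ggood.1.
set H := A `|` G in PA *.
have Hg : H !=set0 by exists g0; right.
have tot x : exists c, H (x, c).
  have [H' [HH' H'good] [c H'c]] := dominated_graph_step x Hg PA.
  exists c; left; apply: contrapT => nAc.
  have PH' : P H'.
    by rewrite /P (_ : H' `|` G = H')//; apply/setUidPl => y Gy; apply: HH'; right.
  apply: (maxA H') => //; split; first by move=> y Ay; apply: HH'; left.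
  by move=> /(_ _ H'c).
have H00 : H (0, 0).
  have [p Hp] := Hg; have := PA.1 (-1) _ _ Hp Hp.
  by rewrite scaler_of_realN1 mulN1r !addNr.
have fle x c d : H (x, c) -> H (x, d) -> c <= d.
  move=> Hc Hd; have := PA.2 _ (PA.1 (-1) _ _ Hd Hc).
  by rewrite /= scaler_of_realN1 mulN1r addNr rnorm0 mulr0 addrC subr_le0.
have feq x c d : H (x, c) -> H (x, d) -> c = d.
  by move=> Hc Hd; apply/le_anti/andP; split; apply: fle; eassumption.
have [u Hu] := choice tot.
exists u; split=> [t x y|x|[x c] Gp].
- by apply: feq (Hu _) _; exact: (PA.1 t _ _ (Hu x) (Hu y)).
- exact: PA.2 _ (Hu x).
- by apply: feq (Hu x) _; right.
Qed.

(* [u] extends the real part of the functional with graph [G]; a complex linear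
   functional f is determined by its real part, as f x = u x - i u (i x). *)
Lemma hahn_banach_graph (G : set (V * K)) : G !=set0 ->
  (forall (a : K) p q, G p -> G q -> G (a *: p.1 + q.1, a * p.2 + q.2)) ->
  (forall p, G p -> rnorm (p.2 : K^o) <= C * rnorm p.1) ->
  exists2 f : dual V, operator_norm f <= C & forall p, G p -> f p.1 = p.2.
Proof.
move=> [g0 Gg0] Gl GC.
pose GR := [set (p.1, re_part p.2) | p in G].
have [||u [ul uC uG]] := @real_hahn_banach GR.
- by exists (g0.1, re_part g0.2), g0.
- split.
    move=> t _ _ [p Gp <-] [q Gq <-] /=.
    exists (of_real t *: p.1 + q.1, of_real t * p.2 + q.2); first exact: Gl.
    by rewrite /= re_partD re_partM re_of_real im_of_real mul0r subr0.
  move=> _ [p Gp <-] /=; rewrite (le_trans _ (GC _ Gp))//.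
  exact: le_trans (ler_norm _) (re_part_le _).
(* Over the reals [i] is 0, and the formulas below remain true. *)
pose i : K := of_parts 0 1.
pose f x : K := of_parts (u x) (- u (i *: x)).
have u0 : u 0 = 0.
  have := ul 1 0 0; rewrite of_real1 scale1r addr0 mul1r => /eqP.
  by rewrite -subr_eq subrr eq_sym => /eqP.
have uD x y : u (x + y) = u x + u y.
  by have := ul 1 x y; rewrite of_real1 scale1r mul1r.
have uZ t x : u (of_real t *: x) = t * u x.
  by have := ul t x 0; rewrite !addr0 u0 addr0.
have uc (a : K) x : u (a *: x) = re_part a * u x + im_part a * u (i *: x).
  rewrite -!uZ -uD scalerA -scalerDl; congr (u (_ *: _)).
  rewrite /i /of_parts; case: (k) a => /= [a|[a b]].
    by rewrite mul0r addr0.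
  by apply/eqP; rewrite eq_complex /=; apply/andP; split; apply/eqP; ring.
have fl : linear f.
  move=> a x y; rewrite /f [RHS]of_parts_linear uD (uc a x); congr of_parts.
    by ring.
  rewrite scalerDr uD scalerA (uc (i * a)) re_partM im_partM.
  have rei : re_part i = 0 by exact: re_of_parts.
  have ima : im_part i * im_part a = im_part a.
    by rewrite /i /of_parts; case: (k) a => /= [a|[a b]]; rewrite ?mulr0 ?mul1r.
  have imu : im_part i * u (i *: x) = u (i *: x).
    by rewrite [RHS]uc rei mul0r add0r.
  rewrite rei ima !mul0r sub0r add0r [_ * re_part a]mulrC -mulrA imu; ring.
have fC x : rnorm (f x : K^o) <= C * rnorm x.
  (* Rotating f x onto its modulus leaves only the bound for the real part u. *)
  have [a a1 afx] := rotation (f x).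
  have : re_part (f (a *: x)) <= C * rnorm x.
    by rewrite re_of_parts (le_trans (uC _))// rnormZ a1 mul1r.
  have -> : f (a *: x) = a * f x.
    have f0 : f 0 = 0 by rewrite /f scaler0 u0 oppr0; apply: scalar_ext;
      rewrite ?re_of_parts ?re_part0//; rewrite im_part0 /of_parts; case: (k).
    by have := fl a x 0; rewrite addr0 f0 addr0.
  by rewrite afx re_of_real.
have fb : f \in @bounded_linear _ _ V K^o.
  by apply/bounded_linearP; split=> //; exists C.
exists (Operator fb); first by apply: operator_norm_le => // x; exact: fC.
move=> [x c] Gp /=; rewrite /f.
rewrite -[c]of_partsK; congr of_parts.
  by apply: (uG (x, re_part c)); exists (x, c).
have G00 : G (0, 0).
  have := Gl (-1) _ _ Gg0 Gg0; rewrite scaleN1r mulN1r.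
  by rewrite !addNr.
have := Gl i _ _ Gp G00; rewrite /= !addr0 => Gi.
have -> : u (i *: x) = re_part (i * c) by apply: (uG (_, _)); exists (i *: x, i * c).
rewrite re_partM /i /of_parts; case: (k) c {Gp Gi} => /= [c|[a b]/=].
  by rewrite !mul0r subr0 oppr0.
by rewrite mul0r mul1r sub0r opprK.
Qed.

End HahnBanach.

(** * Separability and dense sequences *)

Section Separability.
Variables (R : realType) (k : scalar_kind).
Local Notation K := (scalars R k).
Implicit Types V : normedModType K.

Lemma ltr_of_real (x y : R) : (of_real x < of_real y :> K) = (x < y).
Proof. by rewrite !lt_def ler_of_real (can_eq (@of_realK R k)). Qed.

Lemma nbhs_rnormP V (x : V) (A : set V) :
  nbhs x A <-> exists2 e : R, 0 < e & forall y, rnorm (x - y) < e -> A y.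
Proof.
split=> [/nbhs_ballP[e e0 eA]|[e e0 eA]].
  have eE : of_real (re_part e) = e by apply: of_real_ge0; exact: ltW.
  exists (re_part e); first by rewrite -ltr_of_real eE of_real0.
  move=> y xy; apply: eA; rewrite -ball_normE /ball_ /= -eE -of_real_rnorm.
  by rewrite ltr_of_real.
apply/nbhs_ballP; exists (of_real e) => /=; first by rewrite -(of_real0 R k) ltr_of_real.
move=> y; rewrite -ball_normE /ball_ /= -of_real_rnorm ltr_of_real; exact: eA.
Qed.

Lemma closure_rnormP V (A : set V) (x : V) :
  closure A x <-> forall e : R, 0 < e -> exists2 y, A y & rnorm (x - y) < e.
Proof.
split=> [xA e e0|xA B /nbhs_rnormP[e e0 eB]].
  have [|y [Ay xy]] := xA [set y | rnorm (x - y) < e]; last by exists y.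
  by apply/nbhs_rnormP; exists e.
by have [y Ay xy] := xA e e0; exists y; split=> //; exact: eB.
Qed.

Lemma invS_lt (e : R) : 0 < e -> exists n, n.+1%:R^-1 < e.
Proof.
move=> e0; have [n _ ne] := near_infty_natSinv_lt (PosNum e0).
by exists n; exact: ne (leqnn n).
Qed.

Lemma half_pow_lt (e : R) : 0 < e ->
  exists n0, forall n, (n0 <= n)%N -> 2^-1 ^+ n < e.
Proof.
move=> e0; have h1 : `|2^-1| < 1 :> R by rewrite ger0_norm ?invf_lt1// ltr1n.
have /cvgrPdist_lt h := cvg_expr h1.
have [m _ mP] := h _ e0.
exists m => n mn; have := mP n mn; rewrite /= sub0r normrN ger0_norm//; exact: exprn_ge0.
Qed.

Definition dense_sequence V (A : set V) (a : nat -> V) : Prop :=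
  (forall n, A (a n)) /\
  forall x, A x -> forall e : R, 0 < e -> exists n, rnorm (x - a n) < e.

Lemma dense_sequence_separable V (A : set V) a :
  dense_sequence A a -> separable_set A.
Proof.
move=> [Aa aA]; exists (range a); first exact: card_image_le.
split=> [_ [n _ <-]//|x Ax].
apply/closure_rnormP => e e0; have [n xn] := aA x Ax e e0.
by exists (a n) => //; exists n.
Qed.

(** Separability is inherited by subsets of a metric space: for each d in D and each n, a point of A
    within 1 / (n + 1) of d is picked whenever there is one. *)
Lemma separable_dense_sequence V (A B : set V) : A `<=` B -> A !=set0 ->
  separable_set B -> exists a, dense_sequence A a.
Proof.
move=> AB [x0 Ax0] [D /countable_injP[f finj] [_ BD]].
pose good (p : nat * nat) y :=
  A y /\ exists d, [/\ D d, f d = p.1 & rnorm (y - d) < p.2.+1%:R^-1].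
have /choice[h hP] p : exists y, A y /\ ((exists z, good p z) -> good p y).
  have [[y gy]|no] := EM (exists z, good p z).
    by exists y; split=> //; exact: gy.1.
  by exists x0; split=> // /no.
exists (fun n => if unpickle n is Some p then h p else x0); split=> [n|x Ax e e0].
  by case: unpickle => // p; exact: (hP p).1.
have [n nd] := invS_lt (divr_gt0 e0 (ltr0Sn R 1)).
have n0 : 0 < n.+1%:R^-1 :> R by rewrite invr_gt0.
have /closure_rnormP/(_ _ n0)[d Dd xd] := BD x (AB _ Ax).
exists (pickle (f d, n)); rewrite pickleK.
have [|_ [d' [Dd' /finj dd' hd]]] := (hP (f d, n)).2.
  by exists x; split=> //; exists d.
rewrite dd' ?inE// in hd.
rewrite (le_lt_trans (rnorm_triangle d _ _))// [ltRHS](splitr e) ltrD//.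
  exact: lt_trans xd _.
by rewrite rnormB (lt_trans hd).
Qed.

Lemma dense_scalars : exists q : nat -> K,
  forall (z : K) (e : R), 0 < e -> exists n, rnorm (z - q n : K^o) < e.
Proof.
exists (fun n => if unpickle n is Some p then of_parts (ratr p.1) (ratr p.2) else 0).
move=> z e e0; have e20 := divr_gt0 e0 (ltr0Sn R 1).
have near_rat (x : R) : exists r : rat, `|x - ratr r| < e / 2.
  have [|r] := @rat_in_itvoo R (x - e / 2) (x + e / 2).
    by rewrite ltrBlDr -addrA ltrDl addr_gt0.
  by rewrite in_itv /= => /andP[r1 r2]; exists r; rewrite distrC ltr_distl r1 r2.
have [r1 zr1] := near_rat (re_part z); have [r2 zr2] := near_rat (im_part z).
exists (pickle (r1, r2)); rewrite pickleK /= (le_lt_trans (rnorm_le_parts _))//.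
rewrite [ltRHS](splitr e) re_partB im_partB re_of_parts ltrD//.
apply: le_lt_trans zr2; rewrite /of_parts; case: (k) z {zr1} => //= z.
by rewrite subr0 normr0.
Qed.

End Separability.

(** * From the range of the adjoint to the range of the operator *)

Section AdjointSeparable.
Variables (R : realType) (k : scalar_kind).
Local Notation K := (scalars R k).

Lemma operator_norm_half (V W : normedModType K) (g : operator V W) :
  exists2 x, rnorm x <= 1 & operator_norm g <= 2 * rnorm (g x).
Proof.
have [g0|g0] := eqVneq (operator_norm g) 0.
  by exists 0; rewrite ?rnorm0// g0 mulr_ge0// rnorm_ge0.
have {}g0 : 0 < operator_norm g by rewrite lt_neqAle eq_sym g0 operator_norm_ge0.
have [||_ [x /closed_unit_ballP x1 <-] gx] := @sup_gt _
    [set rnorm (g x) | x in closed_unit_ball V] (operator_norm g / 2).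
- by exists (rnorm (g 0)), 0 => //; apply/closed_unit_ballP; rewrite rnorm0.
- by rewrite ltr_pdivrMr// ltr_pMr// ltr1n.
by exists x => //; rewrite -ler_pdivrMl// mulrC ltW.
Qed.

Lemma adjointE (V W : normedModType K) (T : operator V W) (f : dual W) x :
  (adjoint T f : dual V) x = f (T x).
Proof. by []. Qed.

Lemma dual_bound (V : normedModType K) (f : dual V) x :
  rnorm (f x : K^o) <= rnorm f * rnorm x.
Proof. by rewrite rnorm_operator; exact: operator_norm_ub. Qed.

Variables E F : normedModType K.

(* Take f_n with T^* f_n dense in the range of T^* and x_n in the unit ball almost
   norming T^* f_n. A functional h that vanishes on the closed span M of the T x_n
   satisfies T^* h = 0, hence M contains the range of T. *)
Lemma dual_range_separable_sub :
  dual_range_separable E F `<=` separable_range E F.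
Proof.
move=> T sT.
have [|a [aT adense]] := separable_dense_sequence (@subset_refl _ _) _ sT.
  by exists (adjoint T 0), 0.
have /choice[f fa] n : exists f : dual F, adjoint T f = a n.
  by have [g _ <-] := aT n; exists g.
have /choice[x xP] n : exists x, rnorm x <= 1 /\ rnorm (a n) <= 2 * rnorm (a n x : K^o).
  by have [x x1 ax] := operator_norm_half (a n); exists x; rewrite rnorm_operator.
have [q qdense] := dense_scalars R k.
(* Coefficients are restricted to the countable dense set [q], so that lists of pairs of integers
   enumerate the combinations. *)
pose e (s : seq (nat * nat)) : E := \sum_(p <- s) q p.2 *: x p.1.
pose M := [set w : F | forall d : R, 0 < d -> exists s, rnorm (w - T (e s)) < d].
have Mlin b w v : M w -> M v -> M (b *: w + v).
  move=> Mw Mv d d0; pose d3 := d / 3; have d30 : 0 < d3 by rewrite divr_gt0.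
  pose B := rnorm (b : K^o) + 1; have B0 : 0 < B by rewrite ltr_wpDl// rnorm_ge0.
  have [s ws] := Mw _ (divr_gt0 d30 B0); have [t vt] := Mv _ d30.
  (* The coefficients [b * q m] leave the countable set; each is replaced by a nearby [q m'], the
     tolerance being halved from one term to the next. *)
  have [s' ss'] : exists s', rnorm (T (b *: e s) - T (e s')) < d3.
    move: (d3) d30; elim: s {ws} => [|[n m] s IH] r r0.
      by exists [::]; rewrite /e !big_nil scaler0 subrr rnorm0.
    have r20 := divr_gt0 r0 (ltr0Sn R 1).
    have [s'] := IH _ r20; rewrite (linearZ_LR T) /= => s'r.
    pose c := rnorm (T (x n)) + 1; have c0 : 0 < c by rewrite ltr_wpDl// rnorm_ge0.
    have [m' m'r] := qdense (b * q m) _ (divr_gt0 r20 c0).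
    exists ((n, m') :: s'); rewrite /e !big_cons /= -!/(e _) scalerDr scalerA !(linearD T) !(linearZ_LR T) /=.
    rewrite opprD addrACA -scalerBl (le_lt_trans (ler_rnormD _ _))// [ltRHS](splitr r).
    rewrite ler_ltD// (rnormZ (_ : K^o)).
    rewrite (le_trans (ler_wpM2r (rnorm_ge0 _) (ltW m'r)))// -mulrA ler_piMr//; first exact: ltW.
    by rewrite ler_pdivrMl// mulr1 lerDl.
  exists (s' ++ t); rewrite /e big_cat /= -!/(e _) (linearD T) opprD addrACA.
  rewrite (le_lt_trans (ler_rnormD _ _))//.
  have -> : d = d3 + d3 + d3 by rewrite /d3; field.
  rewrite ltrD// (le_lt_trans (rnorm_triangle (T (b *: e s)) _ _))//.
  rewrite ler_ltD// (linearZ_LR T) -scalerBr (rnormZ (b : K^o)).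
  rewrite (le_trans (ler_wpM2l (rnorm_ge0 _) (ltW ws)))// mulrCA ler_piMr//; first exact: ltW.
  by rewrite ler_pdivrMr// mul1r lerDl.
have M0 : M 0 by move=> d d0; exists [::]; rewrite /e big_nil linear0 subr0 rnorm0.
suff TM : range T `<=` M.
  apply: (@dense_sequence_separable _ _ _ _ (fun n => T (e (odflt [::] (unpickle n))))).
  split=> [n|_ [y _ <-] d d0]; first by eexists.
  by have [s sd] := TM _ (ex_intro2 _ _ y I erefl) d d0; exists (pickle s); rewrite pickleK.
move=> _ [y0 _ <-]; apply: contrapT => nM.
have [d d0 dM] : exists2 d : R, 0 < d & forall v, M v -> d <= rnorm (T y0 - v).
  apply: contrapT => no; apply: nM => d d0; apply: contrapT => no'; apply: no.
  have d20 := divr_gt0 d0 (ltr0Sn R 1).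
  exists (d / 2) => // v Mv; rewrite leNgt; apply/negP => vd; apply: no'.
  have [s vs] := Mv _ d20; exists s.
  by rewrite (le_lt_trans (rnorm_triangle v _ _))// [ltRHS](splitr d) ltrD.
have Mx n : M (T (x n)).
  move=> r r0; pose c := rnorm (T (x n)) + 1; have c0 : 0 < c by rewrite ltr_wpDl// rnorm_ge0.
  have [m m1] := qdense 1 _ (divr_gt0 r0 c0).
  exists [:: (n, m)]; rewrite /e big_seq1 (linearZ_LR T) /= -[X in X - _]scale1r -scalerBl.
  rewrite (rnormZ (_ : K^o)) -(@ltr_pM2r _ c)// in m1 *.
  rewrite mulfVK ?gt_eqF// in m1; rewrite (le_lt_trans _ m1)//.
  by rewrite ler_wpM2l ?rnorm_ge0// lerDl.
(* The functional on M + K T y0 that is 0 on M and 1 at T y0. Its norm is at most 1 / d because |v +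
   c T y0| = |c| |T y0 + v / c| >= |c| d. *)
pose G := [set p : F * K | exists2 v, M v & p.1 = v + p.2 *: T y0].
have dV0 : 0 <= d^-1 by rewrite invr_ge0 ltW.
have [|||h _ hG] := @hahn_banach_graph R k F d^-1 dV0 G.
- by exists (0, 0), 0 => //=; rewrite scale0r addr0.
- move=> b p p' [v Mv pv] [v' Mv' pv']; exists (b *: v + v'); first exact: Mlin.
  by rewrite /= pv pv' scalerDr scalerA scalerDl addrACA.
- move=> [w c] [v Mv /= ->]; have [->|c0] := eqVneq c 0.
    by rewrite rnorm0 mulr_ge0 ?rnorm_ge0// invr_ge0 ltW.
  rewrite mulrC ler_pdivlMr//.
  have -> : v + c *: T y0 = c *: (T y0 - (- c^-1 *: v)).
    by rewrite scaleNr opprK scalerDr scalerA mulfV// scale1r addrC.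
  rewrite (rnormZ (_ : K^o)) ler_wpM2l ?rnorm_ge0// dM//.
  by rewrite -[_ *: v]addr0; exact: Mlin.
have hM v : M v -> h v = 0 by move=> Mv; apply: (hG (v, 0)); exists v => //=; rewrite scale0r addr0.
have hy : h (T y0) = 1 by apply: (hG (_, 1)); exists 0 => //=; rewrite scale1r add0r.
suff : adjoint T h = 0.
  by move=> /(congr1 (fun g : dual E => g y0)); rewrite adjointE hy => /eqP; rewrite oner_eq0.
apply: rnorm_eq0; apply/le_anti; rewrite rnorm_ge0 andbT.
apply/ler_addgt0Pl => r r0; rewrite addr0.
have r30 : 0 < r / 3 by rewrite divr_gt0.
have [n hn] := adense _ (ex_intro2 _ _ h I erefl) _ r30.
have [xn1 an] := xP n.
(* Since h vanishes at T (x n), this is also a value of [a n - adjoint T h], which is small; as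
   [x n] almost norms [a n], the norm of [adjoint T h] is at most r / 3 + 2 r / 3. *)
have anx : rnorm (a n (x n) : K^o) <= r / 3.
  have -> : a n (x n) = (a n - adjoint T h : dual E) (x n).
    by rewrite [RHS]/(a n (x n) - h (T (x n))) (hM _ (Mx n)); exact/esym/subr0.
  rewrite (le_trans (dual_bound _ _))// rnormB.
  by rewrite (le_trans (ler_wpM2l (rnorm_ge0 _) xn1))// mulr1 ltW.
rewrite -[adjoint T h](subrK (a n)) (le_trans (ler_rnormD _ _))//.
have -> : r = r / 3 + 2 * (r / 3) by field.
by rewrite lerD ?(ltW hn)// (le_trans an)// ler_pM2l.
Qed.

End AdjointSeparable.

(** * The weak* topology and countable Szlenk indices *)

Section WeakStar.
Variables (R : realType) (k : scalar_kind).
Local Notation K := (scalars R k).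
Variable E : normedModType K.
Implicit Types (phi psi : dual E).

Lemma weak_star_eval_continuous (e : E) :
  continuous (fun phi : weak_star E => (phi : dual E) e).
Proof.
move=> phi; apply: (@continuous_comp _ _ _
  (fun p : weak_star E => (p : dual E) : {ptws E -> K^o}) (fun g => g e)).
  exact: initial_continuous.
exact: (@proj_continuous E (fun=> K^o) e).
Qed.

Lemma weak_star_eval_open (e : E) (c : K) (r : R) :
  open ([set phi | rnorm (phi e - c : K^o) < r] : set (weak_star E)).
Proof.
have oB : open [set w : K^o | rnorm (w - c : K^o) < r].
  rewrite openE => w /= wr; apply/nbhs_rnormP.
  exists (r - rnorm (w - c : K^o)); first by rewrite subr_gt0.
  move=> v wv; apply: le_lt_trans (rnorm_triangle (w : K^o) _ _) _.
  by rewrite -ltrBrDr rnormB.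
by have /continuousP/(_ _ oB) := @weak_star_eval_continuous e.
Qed.

Lemma weak_star_re_open (x : E) (D : set R) : open D ->
  open ([set phi | D (re_part (phi x))] : set (weak_star E)).
Proof.
move=> oD.
have oB : open [set z : K^o | D (re_part z)].
  rewrite openE => z /= Dz; apply/nbhs_rnormP.
  have /nbhs_ballP[e e0 eD] := open_nbhs_nbhs (conj oD Dz).
  exists e => // v zv; apply: eD; rewrite /ball /= -re_partB.
  exact: le_lt_trans (re_part_le _) zv.
by have /continuousP/(_ _ oB) := @weak_star_eval_continuous x.
Qed.

Definition basic_nbhs (s : seq E) (r : R) phi : set (dual E) :=
  [set psi | forall e, e \in s -> rnorm (psi e - phi e : K^o) < r].

(** The basic neighbourhoods of [phi] generate a filter that converges pointwise to [phi], and
    therefore contains every weak* open set around it. *)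
Lemma weak_star_basic (V : set (weak_star E)) phi : open V -> V phi ->
  exists s, exists2 r, 0 < r & basic_nbhs s r phi `<=` V.
Proof.
move=> [B oB <-] Bphi.
pose FF : set_system (dual E) :=
  [set A | exists s, exists2 r, 0 < r & basic_nbhs s r phi `<=` A].
have FFf : Filter FF.
  split.
  - by exists [::], 1.
  - move=> A A' [s [r r0 sA]] [s' [r' r'0 sA']].
    exists (s ++ s'), (Num.min r r'); first by rewrite lt_min r0.
    move=> psi h; split; [apply: sA|apply: sA'] => e es.
      by rewrite (lt_le_trans (h e _)) ?ge_min ?lexx// mem_cat es.
    by rewrite (lt_le_trans (h e _)) ?ge_min ?lexx ?orbT// mem_cat es orbT.
  - by move=> A A' AA' [s [r r0 sA]]; exists s, r => //; exact: subset_trans AA'.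
have : {ptws, (fun psi => psi : {ptws E -> K^o}) @ FF --> (phi : {ptws E -> K^o})}.
  apply/pointwise_cvgP => e A /nbhs_rnormP[r r0 rA].
  exists [:: e], r => // psi h; apply: rA.
  by rewrite rnormB; apply: h; rewrite inE.
by move/(_ B); apply; exact: open_nbhs_nbhs.
Qed.
End WeakStar.

(** * Szlenk derivatives for an operator with separable range *)

Section SzlenkSeparable.
Variables (R : realType) (k : scalar_kind).
Local Notation K := (scalars R k).
Variables E F : normedModType K.
Variable T : operator E F.

Definition adjoint_ball : set (dual E) := adjoint T @` closed_unit_ball (dual F).

(** This is where the range of T enters: evaluations at points whose images under T are dense
    control all evaluations, uniformly on the ball. *)
Lemma adjoint_ball_lipschitz phi x y : adjoint_ball phi ->
  rnorm (phi x - phi y : K^o) <= rnorm (T x - T y).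
Proof.
move=> [f /closed_unit_ballP f1 <-]; rewrite !adjointE -(linearB f).
by rewrite (le_trans (dual_bound _ _))// ler_piMl// rnorm_ge0.
Qed.

(** The base consists of the sets of all phi with |phi (z n) - q m| < 1 / (N + 1) for finitely many
    pairs (n, m), where the T (z n) are dense in the range. It is a base only for the traces on the
    ball. *)
Lemma weak_star_countable_basis : separable_range E F T ->
  exists U : nat -> set (weak_star E), (forall n, open (U n)) /\
    forall (V : set (weak_star E)) phi, open V -> V phi -> adjoint_ball phi ->
      exists2 n, U n phi & U n `&` adjoint_ball `<=` V.
Proof.
move=> /(separable_dense_sequence (@subset_refl _ _))[|a [aT adense]].
  by exists (T 0), 0.
have /choice[z za] n : exists x, T x = a n by have [x _ <-] := aT n; exists x.
have [q qdense] := dense_scalars R k.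
pose cyl (N : nat) (s : seq (nat * nat)) : set (weak_star E) :=
  [set phi : dual E | forall c, c \in s -> rnorm (phi (z c.1) - q c.2 : K^o) < N.+1%:R^-1].
have ocyl N s : open (cyl N s).
  elim: s => [|c s IH]; first by rewrite (_ : cyl N [::] = setT)//; [exact: openT|exact/seteqP].
  rewrite (_ : cyl N (c :: s) =
    [set phi | rnorm ((phi : dual E) (z c.1) - q c.2 : K^o) < N.+1%:R^-1] `&` cyl N s).
    by apply: openI => //; exact: weak_star_eval_open.
  apply/seteqP; split=> [phi h|phi [h1 h2] c']; last by rewrite inE => /predU1P[->|]; [exact: h1|exact: h2].
  by split=> [|c' c's]; apply: h; rewrite inE ?eqxx ?c's ?orbT.
exists (fun n => if unpickle n is Some p then cyl p.1 p.2 else set0).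
split=> [n|V phi oV Vphi Kphi]; first by case: unpickle => [p|]; [exact: ocyl|exact: open0].
have [s [r r0 sV]] := weak_star_basic oV Vphi.
have r40 : 0 < r / 4 by rewrite divr_gt0.
have [N Nr] := invS_lt r40.
have /choice[h hP] e : exists c, rnorm (T e - T (z c.1)) < r / 4 /\
    rnorm (phi (z c.1) - q c.2 : K^o) < N.+1%:R^-1.
  have [n en] := adense (T e) (ex_intro2 _ _ e I erefl) _ r40.
  have [|m nm] := qdense (phi (z n)) N.+1%:R^-1; first by rewrite invr_gt0.
  by exists (n, m); rewrite /= za.
exists (pickle (N, map h s)); rewrite pickleK /=.
  by move=> _ /mapP[e _ ->]; exact: (hP e).2.
move=> psi [cpsi Kpsi]; apply: sV => e es.
have [h1 h2] := hP e; have h3 := cpsi _ (map_f h es).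
have h4 := le_lt_trans (adjoint_ball_lipschitz e (z (h e).1) Kpsi) h1.
have h5 := le_lt_trans (adjoint_ball_lipschitz e (z (h e).1) Kphi) h1.
apply: le_lt_trans (rnorm_triangle (psi (z (h e).1) : K^o) _ _) _.
(* The path from psi e to phi e goes through psi (z n), the scalar q m and phi (z n). *)
have -> : r = r / 4 + (r / 4 + (r / 4 + r / 4)) by field.
apply: ltrD => //.
apply: le_lt_trans (rnorm_triangle (q (h e).2 : K^o) _ _) _.
apply: ltrD; first exact: lt_trans Nr.
apply: le_lt_trans (rnorm_triangle (phi (z (h e).1) : K^o) _ _) _.
by apply: ltrD; rewrite rnormB//; exact: lt_trans Nr.
Qed.

Lemma szlenk_iter_eps (e e' : R) (A : set (dual E)) a : e' <= e ->
  szlenk_iter e A a `<=` szlenk_iter e' A a.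
Proof.
move=> e'e; elim: a => [//|a IH x|J i0 f IH x /= xf i]; last exact: IH.
move=> /(szlenk_derivativeS IH)[xa xV]; split=> // V oV Vx.
by apply: le_lt_trans (xV V oV Vx); rewrite lee_fin.
Qed.

(** A point cannot be lost for the first time at a supremum, where sets are intersected; it is lost
    at a successor. *)
Lemma szlenk_iter_rank e (A : set (dual E)) a x : A x -> ~ szlenk_iter e A a x ->
  exists2 b, szlenk_iter e A b x & ~ szlenk_iter e A (osucc b) x.
Proof.
move=> Ax; elim: a => [//|a IH|J i0 f IH].
  by have [xa xsa|/IH//] := EM (szlenk_iter e A a x); exists a.
by move=> nx; have [i /IH] : exists i, ~ szlenk_iter e A (f i) x by exact/existsNP.
Qed.

Lemma not_szlenk_derivative e (A : set (dual E)) x : A x -> ~ szlenk_derivative e A x ->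
  exists2 V : set (weak_star E), open V /\ V x & (norm_diam (A `&` V) <= e%:E)%E.
Proof.
move=> Ax nx; apply: contrapT => no; apply: nx; split=> // V oV Vx.
by rewrite ltNge; apply/negP => h; apply: no; exists V.
Qed.

Lemma norm_diam_ub (A : set (dual E)) x y (e : R) : (norm_diam A <= e%:E)%E ->
  A x -> A y -> rnorm (x - y) <= e.
Proof.
move=> Ae Ax Ay; rewrite -lee_fin; apply: le_trans Ae.
by apply: ereal_sup_ubound; exists (x, y).
Qed.

Lemma norm_diamS (A B : set (dual E)) : A `<=` B -> (norm_diam A <= norm_diam B)%E.
Proof.
move=> AB; apply: ereal_sup_le; apply: image_subset.
by move=> [y z] [/AB ? /AB ?].
Qed.

(* Every b such that the b-th derivative s^b is nonempty is, up to equivalence,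
   determined by a basic open set that meets s^b but not s^(b+1). *)
Lemma countable_szlenk_index : separable_range E F T ->
  (forall e (L : set (dual E)), 0 < e -> L `<=` adjoint_ball -> L !=set0 ->
     ~ L `<=` szlenk_derivative e L) ->
  exists2 a, olt a omega1 & forall b, Sz_op T b -> olt b a.
Proof.
move=> /weak_star_countable_basis[U [oU Ubasis]] NP.
pose s (j : nat) := szlenk_iter j.+1%:R^-1 adjoint_ball.
pose good (p : nat * nat) b := s p.1 b `&` U p.2 !=set0 /\ s p.1 (osucc b) `&` U p.2 = set0.
(* If b < b', the derivative of order b' lies in that of order b + 1, which misses the basic open
   set. *)
have good_le p b b' : good p b -> good p b' -> ole b' b.
  move=> [_ sb] [[x [sb'x Ux]] _]; have [//|bb'] := ole_total b' b.
  have : (s p.1 (osucc b) `&` U p.2) x by split=> //; exact: szlenk_iter_anti bb' _ sb'x.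
  by rewrite sb.
have /choice[g gP] n : exists b, (exists2 p, unpickle n = Some p & good p b) \/
    (b = ozero /\ ~ exists2 p, unpickle n = Some p & exists b', good p b').
  have [[p np [b gb]]|no] := EM (exists2 p, unpickle n = Some p & exists b', good p b').
    by exists b; left; exists p.
  by exists ozero; right.
have sub j b : s j b `<=` adjoint_ball by apply: (@szlenk_iter_anti _ _ _ _ _ ozero).
have enum j b : s j b !=set0 -> exists n, ole b (g n) /\ ole (g n) b.
  move=> sb; have j0 : 0 < j.+1%:R^-1 :> R by rewrite invr_gt0.
  have [x sbx nx] : exists2 x, s j b x & ~ s j (osucc b) x.
    apply: contrapT => no; apply: (NP _ _ j0 (sub j b) sb) => x sbx.
    by apply: contrapT => nx; apply: no; exists x.
  have [V [oV Vx] dV] := not_szlenk_derivative sbx nx.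
  have [n Unx UnV] := Ubasis V x oV Vx (sub _ _ _ sbx).
  have gb : good (j, n) b.
    split; first by exists x.
    apply/seteqP; split=> // y [[_ sy] Uy].
    have /= := sy _ (oU n) Uy; rewrite ltNge => /negP; apply.
    apply: le_trans dV; apply: norm_diamS => w [sw Uw]; split=> //.
    by apply: UnV; split=> //; exact: sub sw.
  exists (pickle (j, n)); have [[p]|[_ []]] := gP (pickle (j, n)); last first.
    by exists (j, n); [rewrite pickleK|exists b].
  by rewrite pickleK => -[<-] gg; split; apply: good_le; eassumption.
(* Every ordinal below this supremum is at most some [g n]; its derivative is then nonempty as well,
   so that g enumerates it. When [g n] is the default [ozero], only 0 is concerned. *)
exists (osup 0%N (fun n => osucc (g n))).
  apply/omega1P; exists g => b [n /= bn].
  have [[p _ [[x [sx _]] _]]|[gn _]] := gP n.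
    by apply: (enum p.1); exists x; exact: szlenk_iter_anti bn _ sx.
  by exists n; split=> //; rewrite gn.
move=> b [e e0 [x sx]]; have [j je] := invS_lt e0.
have [|n [bn _]] := enum j b; first by exists x; exact: szlenk_iter_eps (ltW je) _ sx.
by exists n.
Qed.

(* For a basic open set U_n, the points x such that diam (s^b `&` U_n) <= eps for
   some b with x in s^b `&` U_n are pairwise within eps: compare their two b's. *)
Lemma szlenk_dual_range_separable a : separable_range E F T -> SZ a T ->
  dual_range_separable E F T.
Proof.
move=> /weak_star_countable_basis[U [oU Ubasis]] SZa.
pose s (j : nat) := szlenk_iter j.+1%:R^-1 adjoint_ball.
pose W (p : nat * nat) x := exists b,
  [/\ s p.1 b x, U p.2 x & (norm_diam (s p.1 b `&` U p.2) <= (p.1.+1%:R^-1)%:E)%E].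
have Wdiam p x y : W p x -> W p y -> rnorm (x - y) <= p.1.+1%:R^-1.
  move=> [b [sx Ux dx]] [c [sy Uy dy]]; have [bc|/oltW cb] := ole_total b c.
    by apply: (norm_diam_ub dx) => //; split=> //; exact: szlenk_iter_anti bc _ sy.
  by apply: (norm_diam_ub dy) => //; split=> //; exact: szlenk_iter_anti cb _ sx.
have sub j b : s j b `<=` adjoint_ball by apply: (@szlenk_iter_anti _ _ _ _ _ ozero).
have Wcover j x : adjoint_ball x -> exists n, W (j, n) x.
  move=> Kx; have [|b sb nsb] := @szlenk_iter_rank j.+1%:R^-1 adjoint_ball (omega_pow a) x Kx.
    move=> sx; apply: (@olt_irrefl (omega_pow a)); apply: SZa.
    by exists j.+1%:R^-1; [rewrite invr_gt0|exists x].
  have [V [oV Vx] dV] := not_szlenk_derivative sb nsb.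
  have [n Unx UnV] := Ubasis V x oV Vx Kx.
  exists n, b; split=> //; apply: le_trans dV; apply: norm_diamS => w [sw Uw]; split=> //.
  by apply: UnV; split=> //; exact: sub sw.
have K0 : adjoint_ball 0.
  by exists 0; [apply/closed_unit_ballP; rewrite rnorm0|exact: linear0].
have /choice[c cP] p : exists x, adjoint_ball x /\ ((exists y, W p y) -> W p x).
  have [[x Wx]|no] := EM (exists y, W p y).
    by exists x; split=> //; case: Wx => b [/sub].
  by exists 0; split=> // /no.
(* The range of the adjoint is the union of the integer multiples of the ball. *)
pose d n := if unpickle n is Some p then of_real p.1%:R *: c p.2 else 0 : dual E.
apply: (@dense_sequence_separable _ _ _ _ d); split=> [n|_ [f _ <-] e e0].
  rewrite /d; case: unpickle => [p|]; last by exists 0 => //; exact: linear0.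
  have [g _ gc] := (cP p.2).1; exists (of_real p.1%:R *: g) => //.
  by rewrite (linearZ_LR (adjoint T)) -gc.
pose N := (Num.truncn (rnorm f)).+1.
have N0 : 0 < N%:R :> R by rewrite ltr0n.
have fN : rnorm f <= N%:R by rewrite ltW// truncnS_gt.
pose x : dual E := of_real N%:R^-1 *: adjoint T f.
have Kx : adjoint_ball x.
  exists (of_real N%:R^-1 *: f); last by rewrite (linearZ_LR (adjoint T)).
  apply/closed_unit_ballP; rewrite rnormZreal ger0_norm ?invr_ge0 ?(ltW N0)//.
  by rewrite ler_pdivrMl// mulr1.
have [j je] := invS_lt (divr_gt0 e0 N0).
have [n Wx] := Wcover j x Kx.
have dE : d (pickle (N, (j, n))) = of_real N%:R *: c (j, n) by rewrite /d pickleK.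
exists (pickle (N, (j, n))); rewrite dE.
have -> : adjoint T f = of_real N%:R *: x.
  by rewrite scalerA -of_realM mulfV ?gt_eqF// of_real1 scale1r.
rewrite -scalerBr rnormZreal ger0_norm ?(ltW N0)// -ltr_pdivlMl// mulrC (le_lt_trans _ je)//.
by apply: (Wdiam (j, n)) => //; apply: (cP (j, n)).2; exists x.
Qed.

End SzlenkSeparable.

(** * Comparison of a with omega^a *)

Lemma ole_oadd a b : ole a (oadd a b).
Proof.
elim: b => [|b IH|J i0 f IH] /=; first exact: ole_refl.
  by apply: oltW; exact: IH.
exact: ole_sup (IH i0).
Qed.

Lemma oadd_ole a b c : ole b c -> ole (oadd a b) (oadd a c).
Proof.
elim: b c => [c _|b IH c|J i0 f IH c bc i]; first exact: ole_oadd; last exact: IH.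
elim: c => [//|c _|J j0 g IHc [j bj]] /=; first exact: IH.
by exists j; exact: IHc.
Qed.

Lemma ole_add0 b : ole b (oadd ozero b).
Proof. by elim: b => [|b IH|J i0 f IH i] //=; apply: ole_sup (IH i). Qed.

Lemma omega_pow_gt0 a : ole (osucc ozero) (omega_pow a).
Proof.
elim: a => [|a IH|J i0 f IH]; [exact: ole_refl| |exact: ole_sup (IH i0)].
by apply: (@ole_sup nat 0%N _ _ 1%N); exact: ole_trans IH (ole_add0 _).
Qed.

(** At a successor, omega^(a+1) >= omega^a + omega^a >= omega^a + 1 >= a + 1; the index 2 below
    selects the second multiple of omega^a. *)
Lemma ole_omega_pow a : ole a (omega_pow a).
Proof.
elim: a => [//|a IH|J i0 f IH i]; last exact: ole_sup (IH i).
apply: (@ole_sup nat 0%N _ _ 2%N).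
have h := oadd_ole (oadd ozero (omega_pow a)) (omega_pow_gt0 a).
by apply: ole_trans h; exact: ole_trans IH (ole_add0 _).
Qed.

(** * Completeness of L_oo *)

Section TotallyBounded.
Variables (R : realType) (k : scalar_kind).
Local Notation K := (scalars R k).
Variable V : normedModType K.

(** An ultrafilter on the closure contains, for each n, a ball of radius 2^-(n+1). The centres move
    by at most 2^-n at each step, and their limit is the limit of the ultrafilter. *)
Lemma totally_bounded_precompact (C : set V) :
  (forall u : nat -> V, (forall n, rnorm (u n - u n.+1) <= 2^-1 ^+ n) ->
     exists l, forall e : R, 0 < e -> exists n0, forall n, (n0 <= n)%N -> rnorm (u n - l) < e) ->
  (forall e : R, 0 < e -> exists N, exists c : nat -> V,
     forall x, C x -> exists2 i, (i < N)%N & rnorm (x - c i) <= e) ->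
  precompact C.
Proof.
move=> complete tb; rewrite precompactE compact_ultra => U UU UC.
have UP : ProperFilter U by exact: ultra_proper.
have ball_in (e : R) : 0 < e -> exists c, U [set x | rnorm (x - c) <= e].
  move=> e0; have [N [c cN]] := tb _ (divr_gt0 e0 (ltr0Sn R 1)).
  apply: contrapT => no.
  have : U [set x | forall i, (i < N)%N -> ~ rnorm (x - c i) <= e].
    elim: N {cN} => [|N IH]; first exact: filterS (@filterT _ U _).
    have [Uc|nUc] := in_ultra_setVsetC [set x | rnorm (x - c N) <= e] UU.
      by case: no; exists (c N).
    apply: filterS (filterI IH nUc) => x [h hN] i.
    by rewrite ltnS leq_eqVlt => /predU1P[->|/h].
  move=> /(filterI UC)/filter_ex[x [/closure_rnormP/(_ _ (divr_gt0 e0 (ltr0Sn R 1)))[y Cy xy]] h].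
  have [i iN yc] := cN y Cy; apply: (h i iN).
  by rewrite (le_trans (rnorm_triangle y _ _))// [leRHS](splitr e) lerD// ltW.
have h0 n : 0 < 2^-1 ^+ n :> R by rewrite exprn_gt0.
have /choice[u uU] n : exists c, U [set x | rnorm (x - c) <= 2^-1 ^+ n.+1].
  exact: ball_in.
have [n|l ul] := complete u.
  have [x [x1 x2]] := filter_ex (filterI (uU n) (uU n.+1)).
  rewrite (le_trans (rnorm_triangle x _ _))// rnormB.
  rewrite (le_trans (lerD x1 x2))// !exprS.
  by move: (2^-1 ^+ n) (h0 n) => a a0; lra.
have Ul : U --> l.
  move=> A /nbhs_rnormP[e e0 eA].
  have e20 := divr_gt0 e0 (ltr0Sn R 1).
  have [n0 n0e] := ul _ e20.
  have [m me] := half_pow_lt e20.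
  pose n := maxn n0 m.
  apply: filterS (uU n) => x xu; apply: eA.
  rewrite (le_lt_trans (rnorm_triangle (u n) _ _))// [ltRHS](splitr e) ltrD//.
    by rewrite rnormB n0e// leq_maxl.
  rewrite rnormB (le_lt_trans xu)//.
  by rewrite me// leqW// leq_maxr.
exists l; split=> //.
rewrite (closure_id (closure C)).1; last exact: closed_closure.
move=> B Bl; have UB := Ul B Bl.
by have [x [Cx Bx]] := filter_ex (filterI UC UB); exists x.
Qed.

End TotallyBounded.

Section LinfTheory.
Context {d : measure_display} {Omega : measurableType d} {R : realType}.
Variables (k : scalar_kind) (mu : {measure set Omega -> \bar R}).
Local Notation K := (scalars R k).
Local Notation L := (Linf k mu).

Lemma Linf_norm_leP (f : Omega -> K^o) (M : R) : 0 <= M ->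
  (Linf_norm mu f <= M%:E)%E <-> \forall w \ae mu, rnorm (f w) <= M.
Proof.
move=> M0; rewrite Linf_normE; case: ifPn => [mu0|mu0].
  by split=> [/ess_supP h|h]; [|apply/ess_supP]; apply: filterS h => w; rewrite lee_fin.
split=> _; last by rewrite lee_fin.
move: mu0; rewrite -leNgt measure_le0 => /eqP mu0.
have := @ae_eq0 _ _ _ mu setT _ (fun=> true) (fun w => rnorm (f w) <= M) measurableT mu0.
by apply: filterS => w /(_ I) <-.
Qed.

Lemma rnorm_Linf_leP (u : L) (M : R) : 0 <= M ->
  rnorm u <= M <-> \forall w \ae mu, rnorm (Linf_val u w) <= M.
Proof.
move=> M0; rewrite rnorm_Linf -(Linf_norm_leP _ M0) -[X in (X <= _)%E]fineK ?lee_fin//.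
exact: Linf_norm_fin.
Qed.

Lemma Linf_ae_le (u : L) : \forall w \ae mu, rnorm (Linf_val u w) <= rnorm u.
Proof. by apply: (rnorm_Linf_leP u (rnorm_ge0 u)).1. Qed.

Lemma Linf_of_fun (f : Omega -> K^o) (M : R) : 0 <= M -> scalar_measurable f ->
  (\forall w \ae mu, rnorm (f w) <= M) -> exists u : L, Linf_val u = f %[ae mu].
Proof.
move=> M0 mf fM.
have fP : f \in @Linf_fun_pred _ _ _ k mu.
  rewrite inE; split=> //; apply: le_lt_trans (ltry M).
  exact/Linf_norm_leP.
exists (\pi_(Quotient.quot (@ae_null _ _ _ k mu))%qT (LinfFun fP)).
exact: Linf_reprE.
Qed.

Lemma Linf_scalar_measurable (u : L) : scalar_measurable (Linf_val u).
Proof. by have := Linf_funP (Linf_repr u); rewrite inE => -[]. Qed.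

Lemma Linf_val_sub (u v : L) : \forall w \ae mu, Linf_val (u - v) w = Linf_val u w - Linf_val v w.
Proof.
have h := Linf_val_add u (- v); have h' := Linf_val_scale (-1) v.
rewrite scaleN1r in h'; apply: filterS2 h h' => w /(_ I) -> /(_ I) /= h.
by congr (_ + _); rewrite h; exact: (@scaleN1r K K^o).
Qed.

(** The intervals of centre x n and radius 2 / 2^n are nested, and l is the supremum of their left
    ends; this gives the rate explicitly. *)
Lemma halving_cvg (x : nat -> R) :
  (forall n, `|x n - x n.+1| <= 2^-1 ^+ n) ->
  exists l, forall n, `|x n - l| <= 2 * 2^-1 ^+ n.
Proof.
move=> xh; pose y n := x n + 2 * 2^-1 ^+ n; pose z n := x n - 2 * 2^-1 ^+ n.
have yS n : y n.+1 <= y n.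
  rewrite /y exprS; have := xh n; rewrite ler_norml => /andP[h _].
  by move: (2^-1 ^+ n) (x n) (x n.+1) h => a b c; lra.
have zS n : z n <= z n.+1.
  rewrite /z exprS; have := xh n; rewrite ler_norml => /andP[_ h].
  by move: (2^-1 ^+ n) (x n) (x n.+1) h => a b c; lra.
have yD n m : (n <= m)%N -> y m <= y n.
  elim: m => [|m IH]; first by rewrite leqn0 => /eqP->.
  by rewrite leq_eqVlt => /predU1P[->//|/IH]; exact: le_trans.
have zD n m : (n <= m)%N -> z n <= z m.
  elim: m => [|m IH]; first by rewrite leqn0 => /eqP->.
  by rewrite leq_eqVlt => /predU1P[->//|/IH h]; exact: le_trans h _.
have zy n m : z n <= y m.
  rewrite (le_trans (zD _ _ (leq_maxl n m)))// (le_trans _ (yD _ _ (leq_maxr n m)))//.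
  have : 0 <= 2^-1 ^+ maxn n m :> R by rewrite exprn_ge0.
  by rewrite /z /y; move: (2^-1 ^+ _) (x _) => a b; lra.
exists (sup (range z)) => n; rewrite ler_distl; apply/andP; split.
  rewrite lerBlDr; apply: ge_sup; first by exists (z 0%N), 0%N.
  by move=> _ [m _ <-]; exact: zy.
rewrite -lerBlDr; apply: ub_le_sup; last by exists n.
by exists (y 0%N) => _ [m _ <-]; exact: zy.
Qed.

Lemma halving_cvgn (x : nat -> R) l :
  (forall n, `|x n - l| <= 2 * 2^-1 ^+ n) -> x @ \oo --> l.
Proof.
move=> xl; apply/cvgrPdist_lt => e e0.
have [n0 n0e] := half_pow_lt (divr_gt0 e0 (ltr0Sn R 1)).
exists n0 => // n /= /n0e; rewrite distrC ltr_pdivlMr// mulrC; exact: le_lt_trans.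
Qed.

Lemma Linf_complete (u : nat -> L) :
  (forall n, rnorm (u n - u n.+1) <= 2^-1 ^+ n) ->
  exists l, forall e : R, 0 < e -> exists n0, forall n, (n0 <= n)%N -> rnorm (u n - l) < e.
Proof.
move=> uh.
have : \forall w \ae mu, forall n, rnorm (Linf_val (u n) w - Linf_val (u n.+1) w : K^o) <= 2^-1 ^+ n.
  apply: ae_foralln => n; have h := Linf_ae_le (u n - u n.+1).
  by apply: filterS2 h (Linf_val_sub (u n) (u n.+1)) => w h <-; exact: le_trans (uh n).
move=> [N [mN N0 NP]].
have lim_part (p : K -> R) : (forall z, `|p z| <= rnorm (z : K^o)) ->
   (forall z z', p (z - z') = p z - p z') ->
   (forall n, measurable_fun setT (p \o Linf_val (u n))) ->
   exists2 g : Omega -> R, measurable_fun setT g &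
     forall w, ~ N w -> forall n, `|p (Linf_val (u n) w) - g w| <= 2 * 2^-1 ^+ n.
  move=> pn pB mp.
  (* The indicator makes the sequence converge at every point, so that its limit is measurable on
     the whole space. *)
  have /choice[g gP] w : exists l, (forall n, `|p (Linf_val (u n) w) * \1_(~` N) w - l| <= 2 * 2^-1 ^+ n).
    apply: halving_cvg => n; have [Nw|Nw] := EM (N w).
      by rewrite indicE memNset ?mulr0 ?subrr ?normr0// exprn_ge0.
    rewrite indicE mem_set// !mulr1 -pB (le_trans (pn _))//.
    by apply: contrapT => h; apply: Nw; apply: NP => /(_ n).
  exists g; last by move=> w Nw n; have := gP w n; rewrite indicE mem_set// mulr1.
  apply: (@measurable_fun_cvg _ _ _ _ (fun n w => p (Linf_val (u n) w) * \1_(~` N) w)).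
    move=> n; apply: measurable_funM; first exact: (mp n).
    by apply: measurable_indic; exact: measurableC.
  by move=> w _; exact: halving_cvgn.
have [g mg gP] := lim_part re_part (@re_part_le R k) (@re_partB R k)
  (fun n => (Linf_scalar_measurable (u n)).1).
have [h mh hP] := lim_part im_part (@im_part_le R k) (@im_partB R k)
  (fun n => (Linf_scalar_measurable (u n)).2).
pose f w : K^o := of_parts (g w) (h w).
have mf : scalar_measurable f.
  split; first by rewrite (_ : _ \o _ = g)//; apply/funext => w; exact: re_of_parts.
  rewrite /f /of_parts; case: (k) => /=; first exact: measurable_cst.
  exact: mh.
have fu w : ~ N w -> forall n, rnorm (Linf_val (u n) w - f w : K^o) <= 4 * 2^-1 ^+ n.
  move=> Nw n; apply: le_trans (rnorm_le_parts _) _.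
  rewrite re_partB im_partB re_of_parts.
  have -> : 4 * 2^-1 ^+ n = 2 * 2^-1 ^+ n + 2 * 2^-1 ^+ n :> R by ring.
  apply: lerD; first exact: gP.
  apply: le_trans (hP w Nw n); rewrite /f /of_parts; move: (Linf_val (u n) w).
  by case: (k) => //= z; rewrite subr0 normr0.
have aeN : \forall w \ae mu, ~ N w.
  by exists N; split=> // w /contrapT.
have f4 : \forall w \ae mu, rnorm (f w) <= rnorm (u 0%N) + 4.
  apply: filterS2 (Linf_ae_le (u 0%N)) aeN => w h1 /fu/(_ 0%N); rewrite expr0 mulr1 => h2.
  rewrite -[f w](subrK (Linf_val (u 0%N) w)) addrC.
  apply: le_trans (ler_rnormD (_ : K^o) _) _; apply: lerD => //.
  by rewrite rnormB.
have [|l lf] := Linf_of_fun _ mf f4; first by rewrite addr_ge0// rnorm_ge0.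
exists l => e e0; have [n0 n0e] := half_pow_lt (divr_gt0 e0 (ltr0Sn R 3)).
exists n0 => n /n0e; rewrite ltr_pdivlMr// mulrC; apply: le_lt_trans.
apply/rnorm_Linf_leP; first by rewrite mulr_ge0// exprn_ge0.
apply: filterS3 (Linf_val_sub (u n) l) lf aeN => w -> /(_ I) -> /fu; exact.
Qed.

End LinfTheory.

(** * Operators with separable adjoint range are Asplund *)

Section PointwiseFunctional.
Variables (R : realType) (k : scalar_kind).
Local Notation K := (scalars R k).

Lemma combination_bound (V : normedModType K) (a b : K) (w w' x x' x'' : V) :
  rnorm (a *: w + w' - x'') <= rnorm (a : K^o) * rnorm (w - x)
    + rnorm (a - b : K^o) * rnorm x + rnorm (w' - x') + rnorm (x' + b *: x - x'').
Proof.
have -> : a *: w + w' - x'' =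
    a *: (w - x) + (a - b) *: x + (w' - x') + (x' + b *: x - x'').
  rewrite scalerBr scalerBl subrKA [X in X + (_ + _ - _)]addrACA -opprD.
  by rewrite [_ *: x + _]addrC subrKA.
rewrite (le_trans (ler_rnormD _ _))// lerD2r (le_trans (ler_rnormD _ _))// lerD2r.
by rewrite (le_trans (ler_rnormD _ _))// !(rnormZ (_ : K^o)).
Qed.

Variable F : normedModType K.

(** The conditions on c are countably many inequalities, the form that survives [almost everywhere].
    Linearity for all scalars is recovered in the closure of the graph of y n |-> c n, to which
    Hahn-Banach applies. *)
Lemma dense_functional (y : nat -> F) (c q : nat -> K) (M : R) : 0 <= M ->
  (forall (z : K) (e : R), 0 < e -> exists n, rnorm (z - q n : K^o) < e) ->
  (forall n n' (b : K) e, 0 < e -> exists m, rnorm (y n + b *: y n' - y m) < e) ->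
  (forall n, rnorm (c n : K^o) <= M * rnorm (y n)) ->
  (forall n n' m n'', rnorm (c n + q m * c n' - c n'' : K^o)
     <= M * rnorm (y n + q m *: y n' - y n'')) ->
  exists f : dual F, forall n, f (y n) = c n.
Proof.
move=> M0 qdense ylin cb clin.
pose G := [set p : F * K | forall e : R, 0 < e ->
  exists n, rnorm (p.1 - y n) < e /\ rnorm (p.2 - c n : K^o) < e].
have Gy n : G (y n, c n).
  by move=> e e0; exists n; rewrite /= !subrr !rnorm0.
have [|||f _ fG] := @hahn_banach_graph R k F M M0 G.
- by exists (y 0%N, c 0%N).
- move=> a [w e] [w' e'] G1 G2 r r0 /=.
  (* One quarter for each of the four terms of [combination_bound], which is used for the vectors
     and for their values with the same indices. *)
  pose s := r / 4; have s0 : 0 < s by rewrite divr_gt0.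
  pose A := rnorm (a : K^o) + 1; have A0 : 0 < A by rewrite ltr_wpDl// rnorm_ge0.
  have [n [/= wn en]] := G1 _ (divr_gt0 s0 A0).
  have [n' [/= wn' en']] := G2 _ s0.
  pose B := rnorm (y n) + rnorm (c n : K^o) + 1.
  have B0 : 0 < B by rewrite ltr_wpDl// addr_ge0// rnorm_ge0.
  have [m am] := qdense a _ (divr_gt0 s0 B0).
  have M1 : 0 < M + 1 by rewrite ltr_wpDl.
  have [n'' yn''] := ylin n' n (q m) _ (divr_gt0 s0 M1).
  have cn'' := clin n' n m n''.
  have rE : r = s + s + s + s by rewrite /s; field.
  have part t : t < s / A -> rnorm (a : K^o) * t <= s.
    move=> /ltW h; rewrite (le_trans (ler_wpM2l (rnorm_ge0 _) h))// mulrCA ler_piMr ?(ltW s0)//.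
    by rewrite ler_pdivrMr// mul1r lerDl.
  have part2 t : 0 <= t -> t <= B -> rnorm (a - q m : K^o) * t <= s.
    move=> t0 tB; rewrite (le_trans (ler_wpM2l (rnorm_ge0 _) tB))//.
    by rewrite -ler_pdivlMr// ltW.
  exists n''; split.
    apply: le_lt_trans (combination_bound _ (q m) _ _ (y n) (y n') _) _.
    rewrite rE ltr_leD//; last first.
      by rewrite (le_trans (ltW yn''))// ler_pdivrMr// ler_peMr ?(ltW s0)// lerDr.
    rewrite ler_ltD// lerD ?part ?part2 ?rnorm_ge0// /B -addrA lerDl addr_ge0 ?rnorm_ge0//.
  apply: le_lt_trans (@combination_bound K^o _ (q m) _ _ (c n) (c n') _) _.
  rewrite rE ltr_leD//; last first.
    apply: (le_trans cn''); rewrite (le_trans (ler_wpM2l M0 (ltW yn'')))// mulrCA.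
    by rewrite ler_piMr ?(ltW s0)// ler_pdivrMr// mul1r lerDl.
  rewrite ler_ltD// lerD ?part ?part2 ?rnorm_ge0//.
  by rewrite /B addrAC lerDr addr_ge0 ?rnorm_ge0.
- move=> [w e] Gw /=; apply/ler_addgt0Pl => r r0.
  have M2 : 0 < M + 1 by rewrite ltr_wpDl.
  have [n [/= wn en]] := Gw _ (divr_gt0 r0 M2).
  rewrite -[e](subrK (c n)); apply: le_trans (ler_rnormD (_ : K^o) _) _.
  have yw : rnorm (y n) <= r / (M + 1) + rnorm w.
    by rewrite -[y n](subrK w) (le_trans (ler_rnormD _ _))// lerD2r rnormB ltW.
  have -> : r = r / (M + 1) + M * (r / (M + 1)) by field; rewrite gt_eqF.
  rewrite -addrA -mulrDr lerD ?(ltW en)// (le_trans (cb n))// ler_wpM2l//.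
by exists f => n; apply: (fG (_, _)).
Qed.

End PointwiseFunctional.

(** Bounded subsets of R^J are totally bounded: each coordinate is rounded to a cell of length e,
    and the boxes are numbered in mixed radix. *)
Lemma finite_code (R : realType) (X : Type) (P : X -> Prop) (p : nat -> X -> R) (e : R) (J : nat) :
  0 < e -> (forall j, exists M, forall x, P x -> `|p j x| <= M) ->
  exists N, exists2 code : X -> nat, (forall x, P x -> (code x < N)%N) &
    forall x y, P x -> P y -> code x = code y ->
      forall j, (j < J)%N -> `|p j x - p j y| <= e.
Proof.
move=> e0 pb; elim: J => [|J [N [code cN cP]]].
  by exists 1%N, (fun=> 0%N).
have [M pM] := pb J.
pose t x := Num.truncn ((p J x + M) / e).
pose N' := (Num.truncn ((M + M) / e)).+1.
have pM0 x : P x -> 0 <= (p J x + M) / e.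
  move=> /pM; rewrite ler_norml => /andP[h _].
  by apply: divr_ge0; [lra|exact: ltW].
have tN x : P x -> (t x < N')%N.
  move=> Px; rewrite ltnS le_truncn// ?ler_pM2r ?invr_gt0// lerD2r.
  by move: (pM _ Px); rewrite ler_norml => /andP[].
exists (N * N')%N, (fun x => code x * N' + t x)%N => [x Px|x y Px Py cxy j].
  rewrite (leq_trans (n := code x * N' + N'))//; first by rewrite ltn_add2l tN.
  by rewrite addnC -mulSn leq_mul2r cN ?orbT.
have tE : t x = t y.
  have := congr1 (modn^~ N') cxy; rewrite /= !modnMDl !modn_small ?tN//.
have cE : code x = code y.
  have := congr1 (divn^~ N') cxy; rewrite /= !divnMDl// !divn_small ?tN// !addn0.
  exact.
rewrite ltnS leq_eqVlt => /predU1P[->|]; last exact: cP.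
have /andP[] := truncn_itv (pM0 _ Px); have /andP[] := truncn_itv (pM0 _ Py).
rewrite -/(t x) -/(t y) tE -!natr1 !ler_pdivlMr// !ltr_pdivrMr//.
move: (t y)%:R (p J x) (p J y) => a b c h1 h2 h3 h4.
by rewrite ler_norml; apply/andP; split; lra.
Qed.

Section ScalarMeasurable.
Context {d : measure_display} {Omega : measurableType d} {R : realType}.
Variables (k : scalar_kind).
Local Notation K := (scalars R k).

Lemma scalar_measurable_rnorm_le (f : Omega -> K^o) (c : K) (r : R) :
  scalar_measurable f -> measurable [set w | rnorm (f w - c : K^o) <= r].
Proof.
move=> [mr mi].
rewrite (_ : [set _ | _] = setT `&` [set w |
    Num.sqrt ((re_part (f w) - re_part c) ^+ 2 + (im_part (f w) - im_part c) ^+ 2) <= cst r w]);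
  last by rewrite setTI; apply/seteqP; split=> w /=; rewrite rnorm_scalarE re_partB im_partB.
apply: measurable_fun_le => //.
apply: (@measurableT_comp _ _ _ _ _ _ (@Num.sqrt R)).
  by apply: continuous_measurable_fun; exact: sqrt_continuous.
apply: measurable_funD; apply: measurable_funX; apply: measurable_funB => //.
Qed.

End ScalarMeasurable.

Section DualSeparableAsplund.
Variables (R : realType) (k : scalar_kind).
Local Notation K := (scalars R k).
Variables E F : normedModType K.
Variable T : operator E F.

(** A single sequence serves both purposes: the integer multiples of points b n of the unit ball
    whose images are dense in that of the ball. The factor 1 gives the second property. *)
Lemma range_ball_sequence : separable_range E F T ->
  exists z : nat -> E,
    (forall x e, 0 < e -> exists n, rnorm (T x - T (z n)) < e) /\
    (forall x e, rnorm x <= 1 -> 0 < e ->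
       exists2 n, rnorm (z n) <= 1 & rnorm (T x - T (z n)) < e).
Proof.
move=> sT.
have [||a [aT adense]] := separable_dense_sequence (A := T @` closed_unit_ball E) _ _ sT.
- by move=> _ [x _ <-]; exists x.
- by exists (T 0), 0 => //; apply/closed_unit_ballP; rewrite rnorm0.
have /choice[b ba] n : exists x, rnorm x <= 1 /\ T x = a n.
  by have [x /closed_unit_ballP x1 <-] := aT n; exists x.
pose z n := if unpickle n is Some p then of_real p.1%:R *: b p.2 else 0.
have zE N n : z (pickle (N, n)) = of_real N%:R *: b n by rewrite /z pickleK.
have near1 x e : rnorm x <= 1 -> 0 < e -> exists n, rnorm (T x - T (b n)) < e.
  move=> x1 e0; have [|n xn] := adense (T x) _ e e0.
    by exists x => //; exact/closed_unit_ballP.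
  by exists n; rewrite (ba n).2.
exists z; split=> [x e e0|x e x1 e0]; last first.
  have [n xn] := near1 x e x1 e0; exists (pickle (1%N, n)).
    by rewrite zE of_real1 scale1r (ba n).1.
  by rewrite zE of_real1 scale1r.
pose N := (Num.truncn (rnorm x)).+1.
have N0 : 0 < N%:R :> R by rewrite ltr0n.
have xN : rnorm x <= N%:R by rewrite ltW// truncnS_gt.
have [|n xn] := near1 (of_real N%:R^-1 *: x) (e / N%:R) _ (divr_gt0 e0 N0).
  rewrite rnormZreal ger0_norm ?invr_ge0 ?(ltW N0)//.
  by rewrite ler_pdivrMl// mulr1.
exists (pickle (N, n)); rewrite zE.
have -> : x = of_real N%:R *: (of_real N%:R^-1 *: x).
  by rewrite scalerA -of_realM mulfV ?gt_eqF// of_real1 scale1r.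
rewrite !(linearZ_LR T) -scalerBr rnormZreal ger0_norm ?(ltW N0)// -ltr_pdivlMl// mulrC.
by move: xn; rewrite (linearZ_LR T).
Qed.

Context {d : measure_display} {Omega : measurableType d}.
Variables (mu : {finite_measure set Omega -> \bar R}) (S : operator F (Linf k mu)).

Lemma operator_Linf_bound (y : F) :
  \forall w \ae mu, rnorm (Linf_val (S y) w) <= operator_norm S * rnorm y.
Proof.
apply: filterS (Linf_ae_le (S y)) => w /le_trans; apply; exact: operator_norm_ub.
Qed.

Lemma operator_Linf_sub (y y' : F) : \forall w \ae mu,
  rnorm (Linf_val (S y) w - Linf_val (S y') w : K^o) <= operator_norm S * rnorm (y - y').
Proof.
have := operator_Linf_bound (y - y'); rewrite (linearB S).
by apply: filterS2 (Linf_val_sub (S y) (S y')) => w ->.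
Qed.

Lemma ae_pointwise_functional (y : nat -> F) :
  (forall n n' (b : K) e, 0 < e -> exists m, rnorm (y n + b *: y n' - y m) < e) ->
  \forall w \ae mu, exists f : dual F, forall n, f (y n) = Linf_val (S (y n)) w.
Proof.
move=> ylin; have [q qdense] := dense_scalars R k.
have h1 : \forall w \ae mu, forall n,
    rnorm (Linf_val (S (y n)) w) <= operator_norm S * rnorm (y n).
  by apply: ae_foralln => n; exact: operator_Linf_bound.
have h2 : \forall w \ae mu, forall n n' m n'',
    rnorm (Linf_val (S (y n)) w + q m * Linf_val (S (y n')) w - Linf_val (S (y n'')) w : K^o)
    <= operator_norm S * rnorm (y n + q m *: y n' - y n'').
  apply: ae_foralln => n; apply: ae_foralln => n'.
  apply: ae_foralln => m; apply: ae_foralln => n''.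
  have := operator_Linf_bound (y n + q m *: y n' - y n'').
  rewrite (linearB S) (linearD S) (linearZ_LR S).
  have e1 := Linf_val_sub (S (y n) + q m *: S (y n')) (S (y n'')).
  have e2 := Linf_val_add (S (y n)) (q m *: S (y n')).
  have e3 := Linf_val_scale (q m) (S (y n')).
  apply: filterS2 (filterI e1 (filterI e2 e3)) => w [-> [/(_ I) -> /(_ I)]] /= h.
  by rewrite h.
apply: filterS2 h1 h2 => w c1 c2.
exact: (dense_functional (operator_norm_ge0 S) qdense ylin c1 c2).
Qed.

(* For almost every w, the map T x |-> (S T x)(w) comes from some f in the dual of F,
   by Hahn-Banach, and T^* f is close to a term of the dense sequence D. *)
Lemma Linf_functional_cover (z : nat -> E) (D : nat -> dual E) (e : R) : 0 < e ->
  (forall x e, 0 < e -> exists n, rnorm (T x - T (z n)) < e) ->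
  (forall f : dual F, forall e, 0 < e -> exists j, rnorm (adjoint T f - D j) < e) ->
  \forall w \ae mu, exists j, forall n, rnorm (z n) <= 1 ->
    rnorm (Linf_val (S (T (z n))) w - D j (z n) : K^o) <= e.
Proof.
move=> e0 zdense Ddense.
have : \forall w \ae mu, exists f : dual F, forall n, f (T (z n)) = Linf_val (S (T (z n))) w.
  apply: ae_pointwise_functional => n n' b r r0.
  have [m mr] := zdense (z n + b *: z n') r r0; exists m.
  by move: mr; rewrite (linearD T) (linearZ_LR T).
apply: filterS => w [f fw]; have [j fj] := Ddense f e e0.
exists j => n zn1; rewrite -fw.
apply: le_trans (_ : rnorm ((adjoint T f - D j : dual E) (z n) : K^o) <= _); first exact: lexx.
rewrite (le_trans (dual_bound _ _))// (le_trans (ler_wpM2l (rnorm_ge0 _) zn1))// mulr1 ltW//.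
Qed.

End DualSeparableAsplund.

Section AlmostCover.
Context {d : measure_display} {Omega : measurableType d} {R : realType}.
Variable mu : {finite_measure set Omega -> \bar R}.

(** For each m a finite union of the A m j misses a set of measure at most eps / 2^(m+2). The total
    loss is at most eps / 2, which gives the strict inequality. *)
Lemma almost_cover (A : nat -> nat -> set Omega) (eps : R) : 0 < eps ->
  (forall m j, measurable (A m j)) ->
  (forall m, \forall w \ae mu, exists j, A m j w) ->
  exists J : nat -> nat,
    let B := \bigcap_m \bigcup_(j in `I_(J m)) A m j in
    measurable B /\ (mu setT - eps%:E < mu B)%E.
Proof.
move=> eps0 mA Acover.
pose U m n := \bigcup_(j in `I_n) A m j.
have mU m n : measurable (U m n) by apply: bigcup_measurable.
have /choice[J JP] m : exists n, (mu (~` U m n) <= (eps / 2 / (2 ^ m.+1)%:R)%:E)%E.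
  have h0 : 0 < eps / 2 / (2 ^ m.+1)%:R :> R by rewrite !divr_gt0// ltr0n expn_gt0.
  have mC : measurable (\bigcap_n ~` U m n).
    by apply: bigcap_measurable => // n _; exact: measurableC.
  have C0 : mu (\bigcap_n ~` U m n) = 0%E.
    apply/negligibleP => //; apply: negligibleS (Acover m) => w Cw [j Aw].
    by apply: (Cw j.+1 I); exists j => //=.
  have : (mu \o (fun n => ~` U m n)) @ \oo --> mu (\bigcap_n ~` U m n).
    apply: nonincreasing_cvg_mu => //.
    - by rewrite ltey_eq fin_num_measure//; exact: measurableC.
    - by move=> n; exact: measurableC.
    - move=> n n' nn'; apply/subsetPset; apply: subsetC => w [j jn Aw]; exists j => //.
      exact: leq_trans jn nn'.
  rewrite C0 => /(_ [set x | (x < (eps / 2 / (2 ^ m.+1)%:R)%:E)%E])[].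
    by apply: open_ereal_lt'; rewrite lte_fin.
  by move=> n _ h; exists n; apply/ltW/(h n) => /=.
exists J => B.
have mB : measurable B by apply: bigcap_measurable => // m _; exact: mU.
split=> //.
have muC : (mu (~` B) <= (eps / 2)%:E)%E.
  apply: le_trans (@epsilon_trick0 R (eps / 2) xpredT _); last by rewrite divr_ge0// ltW.
  apply: le_trans (_ : (\sum_(0 <= m <oo) mu (~` U m (J m)) <= _)%E).
    apply: measure_sigma_subadditive => [m||]; try exact: measurableC.
    by rewrite /B setC_bigcap.
  by apply: lee_nneseries => // m _.
have BC : mu setT = (mu B + mu (~` B))%E.
  by rewrite -(setUv B) measureU//; [exact: measurableC|exact: setICr].
rewrite BC -(fineK (fin_num_measure mu B mB)) -(fineK (fin_num_measure mu _ (measurableC mB))).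
rewrite -(fineK (fin_num_measure mu _ (measurableC mB))) lee_fin in muC.
rewrite -EFinD lte_fin.
by move: (fine _) (fine _) muC => a b; lra.
Qed.

End AlmostCover.

Section DualSeparableIsAsplund.
Variables (R : realType) (k : scalar_kind).
Local Notation K := (scalars R k).
Variables E F : normedModType K.

(** Passage from the sequence z to an arbitrary x of the unit ball; the exceptional null set may
    depend on x. *)
Lemma Linf_approximation (T : operator E F) (d : measure_display) (Omega : measurableType d)
    (mu : {finite_measure set Omega -> \bar R}) (S : operator F (Linf k mu))
    (z : nat -> E) (f : dual F) (e : R) (x : E) : 0 < e -> rnorm x <= 1 ->
  (forall x e, rnorm x <= 1 -> 0 < e ->
       exists2 n, rnorm (z n) <= 1 & rnorm (T x - T (z n)) < e) ->
  \forall w \ae mu,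
    (forall n, rnorm (z n) <= 1 ->
       rnorm (Linf_val (S (T (z n))) w - f (T (z n)) : K^o) <= e) ->
    rnorm (Linf_val (S (T x)) w - f (T x) : K^o) <= 2 * e.
Proof.
move=> e0 x1 zdense.
pose M := operator_norm S + rnorm f + 1.
have M0 : 0 < M by rewrite ltr_wpDl// addr_ge0// ?operator_norm_ge0 ?rnorm_ge0.
have [n zn1 xn] := zdense x _ x1 (divr_gt0 e0 M0).
apply: filterS (operator_Linf_sub S (T x) (T (z n))) => w h /(_ n zn1) hn.
apply: le_trans (rnorm_triangle (Linf_val (S (T (z n))) w : K^o) _ _) _.
have h2 : rnorm (f (T (z n)) - f (T x) : K^o) <= rnorm f * rnorm (T x - T (z n)).
  by rewrite -(linearB f) [rnorm (T x - _)]rnormB; exact: dual_bound.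
have h3 : (operator_norm S + rnorm f) * rnorm (T x - T (z n)) <= e.
  apply: le_trans (_ : M * rnorm (T x - T (z n)) <= _).
    by rewrite ler_wpM2r ?rnorm_ge0// lerDl.
  by rewrite -ler_pdivlMl// mulrC ltW.
rewrite mulrDl in h3.
have h4 := rnorm_triangle (f (T (z n)) : K^o) (Linf_val (S (T (z n))) w) (f (T x)).
by move: h h2 h3 h4 hn; do 6 move: (rnorm _) => ?; lra.
Qed.

(** At each w in B, the value (S T x)(w) is close to D j x for some j < J m that depends on w but
    not on x. Hence the finitely many numbers D j x with j < J m, bounded on the unit ball,
    determine S T x on B up to a small error. *)
Lemma dual_range_separable_asplund : dual_range_separable E F `<=` asplund E F.
Proof.
move=> T sT d Omega mu S eps eps0.
have [z [zdense zball]] := range_ball_sequence (dual_range_separable_sub sT).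
have [|D [DT Ddense]] := separable_dense_sequence (@subset_refl _ _) _ sT.
  by exists (adjoint T 0), 0.
have /choice[f fD] j : exists f : dual F, adjoint T f = D j.
  by have [g _ <-] := DT j; exists g.
pose A m j := [set w | forall n, rnorm (z n) <= 1 ->
  rnorm (Linf_val (S (T (z n))) w - D j (z n) : K^o) <= m.+1%:R^-1].
have mA m j : measurable (A m j).
  rewrite (_ : A m j = \bigcap_(n in [set n | rnorm (z n) <= 1])
    [set w | rnorm (Linf_val (S (T (z n))) w - D j (z n) : K^o) <= m.+1%:R^-1]); last first.
    by apply/seteqP; split=> w h n; exact: h.
  have [->|P0] := eqVneq [set n | rnorm (z n) <= 1] set0; first by rewrite bigcap_set0.
  apply: bigcap_measurable; first exact/set0P.
  by move=> n _; apply: scalar_measurable_rnorm_le; exact: Linf_scalar_measurable.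
have Acover m : \forall w \ae mu, exists j, A m j w.
  have h : 0 < m.+1%:R^-1 :> R by rewrite invr_gt0.
  by apply: (Linf_functional_cover S h zdense) => g e e0; apply: Ddense => //; exists g.
have [J /= [mB Beps]] := almost_cover eps0 mA Acover.
set B := \bigcap_m _ in mB Beps.
exists B; split=> //.
apply: totally_bounded_precompact; first exact: Linf_complete.
move=> e e0.
(* Three errors of at most 2 e / 8 are added: at x, at y, and between D j x and D j y. *)
have [m me] := invS_lt (divr_gt0 e0 (ltr0Sn R 7)).
(* Real parts are stored at even indices and imaginary parts at odd ones, whence [(J m).*2]
   coordinates. *)
pose p j (x : E) := if odd j then im_part (D j./2 x : K) else re_part (D j./2 x : K).
have pb j : exists M, forall x, rnorm x <= 1 -> `|p j x| <= M.
  exists (rnorm (D j./2)) => x x1.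
  have : rnorm (D j./2 x : K^o) <= rnorm (D j./2).
    by rewrite (le_trans (dual_bound _ _))// ler_piMr// rnorm_ge0.
  apply: le_trans; rewrite /p; case: odd; [exact: im_part_le|exact: re_part_le].
have [N [code codeN codeP]] := finite_code (J m).*2 (divr_gt0 e0 (ltr0Sn R 7)) pb.
pose img (g : Linf k mu) x := rnorm x <= 1 /\
  Linf_val g = (fun w => Linf_val (S (T x)) w * \1_B w) %[ae mu].
exists N.
(* The net is made of one member of the set for each code in use, with default 0. *)
have /choice[c cP] i : exists c, forall g x, img g x -> code x = i ->
    exists2 y, img c y & code y = i.
  have [[g [x [gx xi]]]|no] := EM (exists g x, img g x /\ code x = i).
    by exists g => *; exists x.
  by exists 0 => g x gx xi; case: no; exists g, x.
exists c => g [_ [x /closed_unit_ballP x1 <-] gx].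
exists (code x); first exact: codeN.
have [y [y1 cy] yx] := cP (code x) g x (conj x1 gx) erefl.
apply/rnorm_Linf_leP; first exact: ltW.
have approx v : rnorm v <= 1 -> \forall w \ae mu, forall j, A m j w ->
    rnorm (Linf_val (S (T v)) w - D j v : K^o) <= 2 * m.+1%:R^-1.
  move=> v1; apply: ae_foralln => j; rewrite -fD.
  have h : 0 < m.+1%:R^-1 :> R by rewrite invr_gt0.
  have := Linf_approximation S (f j) h v1 zball.
  by apply: filterS => w + Aw; apply => n zn; rewrite -adjointE fD; exact: Aw.
apply: filterS (filterI (filterI (approx x x1) (approx y y1))
  (filterI (Linf_val_sub g (c (code x))) (filterI gx cy))) => w [[hx hy] [-> [/(_ I) -> /(_ I) ->]]].
have [Bw|nBw] := EM (B w); last first.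
  by rewrite indicE memNset// !mulr0 subrr rnorm0 ltW.
rewrite indicE mem_set// !mulr1.
have [j /= jJ Ajw] := Bw m I.
have Dxy : rnorm (D j x - D j y : K^o) <= 2 * (e / 8).
  apply: le_trans (rnorm_le_parts _) _; rewrite re_partB im_partB mulr_natl mulr2n lerD//.
    have := codeP x y x1 y1 (esym yx) j.*2; rewrite /p odd_double doubleK.
    by apply; rewrite ltn_double.
  have := codeP x y x1 y1 (esym yx) j.*2.+1; rewrite /p /= odd_double /= uphalf_double.
  by apply; rewrite -doubleS leq_double.
have := rnorm_triangle (D j x : K^o) (Linf_val (S (T x)) w) (Linf_val (S (T y)) w).
have := rnorm_triangle (D j y : K^o) (D j x) (Linf_val (S (T y)) w).
have := hx j Ajw; have := hy j Ajw; rewrite [rnorm (Linf_val (S (T y)) w - _)]rnormB.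
by move: Dxy me; do 5 move: (rnorm _) => ?; move: (m.+1%:R^-1) => ?; lra.
Qed.

End DualSeparableIsAsplund.

(** * Weak* limits of bounded functions *)

Section FiniteMeasureDensity.
Context {d : measure_display} {Omega : measurableType d} {R : realType}.
Variable mu : {finite_measure set Omega -> \bar R}.

Lemma bounded_integrable (f : Omega -> R) (M : R) (D : set Omega) : measurable D ->
  measurable_fun setT f -> (\forall w \ae mu, `|f w| <= M) ->
  mu.-integrable D (EFin \o f).
Proof.
move=> mD mf fM; apply: (@integrableS _ _ _ _ setT) => //.
apply/integrableP; split; first exact/measurable_EFinP.
apply: le_lt_trans (_ : (\int[mu]_x (cst (Num.max M 0)%:E x) < +oo)%E).
  apply: ae_ge0_le_integral => //.
  - by apply: measurableT_comp => //; exact/measurable_EFinP.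
  - by move=> w _; rewrite lee_fin le_max lexx orbT.
  - by apply: filterS fM => w h _; rewrite /= lee_fin le_max h.
rewrite integral_cst// lte_mul_pinfty// ?lee_fin ?le_max ?lexx ?orbT//.
by rewrite ltey_eq fin_num_measure.
Qed.

(** The hypothesis, tested on the points of A where g >= h + 1 / (j + 1), shows that these form a
    null set for each j. *)
Lemma ae_le_Rintegral (A : set Omega) (g h : Omega -> R) : measurable A ->
  measurable_fun setT g -> measurable_fun setT h ->
  mu.-integrable setT (EFin \o g) -> mu.-integrable setT (EFin \o h) ->
  (forall E, E `<=` A -> measurable E ->
     Rintegral mu E g <= Rintegral mu E h) ->
  \forall w \ae mu, A w -> g w <= h w.
Proof.
move=> mA mg mh ig ih gh.
pose E j := A `&` [set w | h w + j.+1%:R^-1 <= g w].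
have mE j : measurable (E j).
  apply: measurable_fun_le => //; apply: measurable_funTS => //.
  by apply: measurable_funD.
have E0 j : mu (E j) = 0%E.
  have iE f : mu.-integrable setT (EFin \o f) -> mu.-integrable (E j) (EFin \o f).
    by move=> i; apply: (@integrableS _ _ _ _ setT).
  have ic : mu.-integrable (E j) (EFin \o cst j.+1%:R^-1).
    by apply: (@bounded_integrable _ `|j.+1%:R^-1|) => //; apply/nearW.
  have h1 : Rintegral mu (E j) h + j.+1%:R^-1 * fine (mu (E j)) <= Rintegral mu (E j) g.
    rewrite -Rintegral_cst// -RintegralD//; last exact: iE.
    apply: le_Rintegral => //; last by move=> w [].
      exact: (integrableD (mE j) (iE _ ih) ic).
    exact: iE.
  have h2 := gh _ (@subIsetl _ _ _) (mE j).
  have h3 : fine (mu (E j)) <= 0.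
    rewrite -(@pmulr_rle0 _ j.+1%:R^-1) ?invr_gt0//.
    by have := le_trans h1 h2; rewrite gerDl.
  apply/eqP; rewrite -measure_le0 -(fineK (fin_num_measure mu _ (mE j))).
  by rewrite lee_fin.
apply: (@negligibleS _ _ _ _ (\bigcup_j E j)).
  move=> w /= /not_implyP[Aw /negP]; rewrite -ltNge => hg.
  have [j jg] := invS_lt (etrans (subr_gt0 _ _) hg).
  by exists j => //; split=> //=; rewrite addrC -lerBrDr ltW.
apply: negligible_bigcup => j; apply/negligibleP; [exact: mE|exact: E0].
Qed.

Section Density.
Variables (nu : set Omega -> R) (M : R).
Hypothesis nuD : forall A B, measurable A -> measurable B -> A `&` B = set0 ->
  nu (A `|` B) = nu A + nu B.
Hypothesis nuM : forall A, measurable A -> `|nu A| <= M * fine (mu A).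

Let Enu : set Omega -> \bar R := EFin \o nu.

Let nu0 : Enu set0 = 0%E.
Proof.
have := nuM measurable0; rewrite measure0 mulr0 normr_le0 => /eqP.
by rewrite /Enu /= => ->.
Qed.

Let nufin A : measurable A -> Enu A \is a fin_num.
Proof. by []. Qed.

(** Finite additivity leaves the value of nu on the tail [W n] as remainder; it is dominated by M mu
    (W n), which tends to 0. *)
Let nu_sigma : semi_sigma_additive Enu.
Proof.
move=> A mA tA mUA.
pose W n := \bigcup_(i in [set i | (n <= i)%N]) A i.
have mW n : measurable (W n) by apply: bigcup_measurable.
have W0 : W 0%N = \bigcup_i A i by apply: eq_bigcupl; split.
have WS n : W n = A n `|` W n.+1.
  apply/seteqP; split=> [w [i /= ni Aiw]|w [Anw|[i /= ni Aiw]]].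
  - by move: ni; rewrite leq_eqVlt => /predU1P[->|ni]; [left|right; exists i].
  - by exists n => //=.
  - by exists i => //=; exact: ltnW.
have AW n : A n `&` W n.+1 = set0.
  apply/seteqP; split=> // w [Anw [i /= ni Aiw]].
  have ni' := tA n i I I (ex_intro _ w (conj Anw Aiw)).
  by move: ni; rewrite ni' ltnn.
have sumW n : \sum_(i < n) nu (A i) = nu (\bigcup_i A i) - nu (W n).
  elim: n => [|n IH]; first by rewrite big_ord0 W0 subrr.
  by rewrite big_ord_recr/= IH (WS n) nuD//; ring.
have muW : mu \o W @ \oo --> 0%E.
  rewrite -(measure0 mu) (_ : set0 = \bigcap_n W n); last first.
    apply/seteqP; split=> // w Ww.
    have [i _ Aiw] := Ww 0%N I; have [j /= ij Ajw] := Ww i.+1 I.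
    have ij' := tA i j I I (ex_intro _ w (conj Aiw Ajw)).
    by move: ij; rewrite ij' ltnn.
  apply: nonincreasing_cvg_mu => //.
  - by rewrite ltey_eq fin_num_measure.
  - exact: bigcap_measurable.
  - move=> n m nm; apply/subsetPset => w [i /= mi Aiw]; exists i => //=.
    exact: leq_trans mi.
rewrite (_ : (fun n => _) = EFin \o (fun n => \sum_(i < n) nu (A i))); last first.
  by apply/funext => n /=; rewrite big_mkord sumEFin.
apply: cvg_EFin; first by apply: nearW.
apply/cvgrPdist_le => e e0.
have fmuW : fine \o (mu \o W) @ \oo --> (0 : R) by apply: fine_cvg muW.
have M0 : 0 < `|M| + 1 by rewrite ltr_wpDl.
have /cvgrPdist_lt/(_ _ (divr_gt0 e0 M0)) := fmuW.
apply: filterS => n /=; rewrite sub0r normrN ger0_norm ?fine_ge0// => h.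
rewrite sumW opprB addrC subrK (le_trans (nuM (mW n)))//.
apply: le_trans (_ : (`|M| + 1) * fine (mu (W n)) <= _).
  by rewrite ler_wpM2r ?fine_ge0// (le_trans (ler_norm M))// lerDl.
by rewrite -ler_pdivlMl// mulrC ltW.
Qed.

HB.instance Definition _ := isCharge.Build _ _ _ Enu nu0 nufin nu_sigma.

Lemma set_function_density : exists2 g : Omega -> R, measurable_fun setT g &
  mu.-integrable setT (EFin \o g) /\
  forall A, measurable A -> nu A = Rintegral mu A g.
Proof.
have dom : Enu `<< mu.
  apply/null_content_dominatesP => A mA A0.
  have := nuM mA; rewrite A0 mulr0 normr_le0 => /eqP.
  by rewrite /Enu /= => ->.
have Ef w : Radon_Nikodym Enu mu w \is a fin_num by exact: Radon_Nikodym_fin_num.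
have If := Radon_Nikodym_integrable (nu := Enu) dom.
pose g w := fine (Radon_Nikodym Enu mu w).
have gE : EFin \o g = Radon_Nikodym Enu mu by apply/funext => w; rewrite /= fineK.
exists g; first by apply/measurable_EFinP; rewrite gE; exact: measurable_int If.
rewrite gE; split=> // A mA.
rewrite /Rintegral (_ : (fun w => (g w)%:E) = Radon_Nikodym Enu mu)//.
by rewrite -(Radon_Nikodym_integral (nu := Enu) dom mA).
Qed.

End Density.
End FiniteMeasureDensity.

(** * Limits along an ultrafilter *)

Lemma ultra_bounded_cvg (R : realType) (U : set_system nat) (x : nat -> R) (M : R) :
  UltraFilter U -> (forall n, `|x n| <= M) -> exists l : R, x @ U --> l.
Proof.
move=> UU xM; have UP : ProperFilter U by exact: ultra_proper.
pose S := [set a | U [set n | a <= x n]].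
have S0 : S !=set0.
  exists (- M); apply: filterS (@filterT _ U _) => n _ /=.
  by have := xM n; rewrite ler_norml => /andP[].
have SM : ubound S M.
  by move=> a /filter_ex[n /= /le_trans]; apply; have := xM n; rewrite ler_norml => /andP[].
have supS : has_sup S by split=> //; exists M.
exists (sup S); apply/cvgrPdist_lt => e e0.
have [a Sa ae] := sup_adherent e0 supS.
have [Sb|nSb] := in_ultra_setVsetC [set n | sup S + e <= x n] UU.
  have : sup S + e <= sup S by apply: ub_le_sup => //; exact: supS.2.
  by rewrite gerDl leNgt e0.
apply: filterS (filterI Sa nSb) => n [/= an /negP]; rewrite -ltNge => nb.
by rewrite distrC ltr_distl (lt_le_trans ae an) nb.
Qed.

Section WeakLimit.
Context {d : measure_display} {Omega : measurableType d} {R : realType}.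
Variable mu : {finite_measure set Omega -> \bar R}.
Variable U : set_system nat.
Context {UP : ProperFilter U}.
Hypothesis UU : UltraFilter U.

(** For bounded sequences this is weak* convergence in L_oo, tested on indicator functions. *)
Definition weak_cvg (u : nat -> Omega -> R) (g : Omega -> R) : Prop :=
  [/\ measurable_fun setT g, mu.-integrable setT (EFin \o g) &
      forall A, measurable A ->
        (fun n => Rintegral mu A (u n)) @ U --> Rintegral mu A g].

Lemma integrable_sub (A : set Omega) (g : Omega -> R) : measurable A ->
  mu.-integrable setT (EFin \o g) -> mu.-integrable A (EFin \o g).
Proof. by move=> mA ig; apply: (@integrableS _ _ _ _ setT). Qed.

Lemma bounded_integrableT (f : Omega -> R) M :
  measurable_fun setT f -> (forall w, `|f w| <= M) -> mu.-integrable setT (EFin \o f).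
Proof. by move=> mf fM; apply: bounded_integrable mf _ => //; apply: nearW fM. Qed.

(** The limits of the integrals over A form a finitely additive function of A dominated by M mu; its
    density is the limit. *)
Lemma weak_cvg_exists (u : nat -> Omega -> R) M :
  (forall n, measurable_fun setT (u n)) -> (forall n w, `|u n w| <= M) ->
  exists g, weak_cvg u g.
Proof.
move=> mu_ uM.
have iu n A : measurable A -> mu.-integrable A (EFin \o u n).
  by move=> mA; apply: integrable_sub => //; exact: bounded_integrableT.
have uA n A : measurable A -> `|Rintegral mu A (u n)| <= M * fine (mu A).
  move=> mA; rewrite (le_trans (le_normr_Rintegral mA (iu n A mA)))// -Rintegral_cst//.
  apply: le_Rintegral => //.
    apply: integrable_sub => //; apply: (@bounded_integrableT _ M); last by move=> w; rewrite normr_id.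
    exact: measurableT_comp.
  by apply: integrable_sub => //; apply: (@bounded_integrableT _ `|M|).
have /choice[nu nuP] A : exists l : R, measurable A ->
    (fun n => Rintegral mu A (u n)) @ U --> l.
  have [mA|nmA] := EM (measurable A); last by exists 0 => /nmA.
  have [l hl] := ultra_bounded_cvg UU (fun n => uA n A mA).
  by exists l.
have [|A mA|g mg [ig nug]] := @set_function_density _ _ _ mu nu M.
- move=> A B mA mB AB.
  have h : (fun n => Rintegral mu (A `|` B) (u n)) @ U --> nu A + nu B.
    rewrite (_ : (fun n => _) = (fun n => Rintegral mu A (u n) + Rintegral mu B (u n))).
      by apply: cvgD; exact: nuP.
    apply/funext => n; apply: Rintegral_setU => //; first exact/iu/measurableU.
    by apply/disj_set2P.
  exact: (cvg_unique (@Rhausdorff R) (nuP _ (measurableU _ _ mA mB)) h).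
- have h := cvg_norm (nuP A mA).
  have hb : \forall n \near U, `|Rintegral mu A (u n)| <= M * fine (mu A).
    by apply: nearW => n; exact: uA.
  exact: (cvgr_to_le (h _) hb).
- by exists g; split=> // A mA; rewrite -nug//; exact: nuP.
Qed.

Lemma weak_cvg_le (u v : nat -> Omega -> R) g h (A : set Omega) : measurable A ->
  weak_cvg u g -> weak_cvg v h ->
  (forall n, mu.-integrable setT (EFin \o u n)) ->
  (forall n, mu.-integrable setT (EFin \o v n)) ->
  (\forall n \near U, forall w, A w -> u n w <= v n w) ->
  \forall w \ae mu, A w -> g w <= h w.
Proof.
move=> mA [mg ig ug] [mh ih vh] iu iv uv.
apply: ae_le_Rintegral => // E EA mE.
apply: ler_cvg_to (ug E mE) (vh E mE) _.
apply: filterS uv => n uvn; apply: le_Rintegral => //; try exact: integrable_sub.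
by move=> w /EA; exact: uvn.
Qed.

Lemma weak_cvg_unique (u : nat -> Omega -> R) g h : 
  weak_cvg u g -> weak_cvg u h -> (forall n, mu.-integrable setT (EFin \o u n)) ->
  g = h %[ae mu].
Proof.
move=> ug uh iu.
have uu : \forall n \near U, forall w, [set: Omega] w -> u n w <= u n w by apply: nearW.
have h1 := weak_cvg_le measurableT ug uh iu iu uu.
have h2 := weak_cvg_le measurableT uh ug iu iu uu.
by apply: filterS2 h1 h2 => w gh hg _; apply/le_anti; rewrite gh// hg.
Qed.

Lemma weak_cvg_cst (c : R) : weak_cvg (fun=> cst c) (cst c).
Proof.
split=> //; first by apply: (@bounded_integrableT _ `|c|).
by move=> A mA; exact: cvg_cst.
Qed.

Lemma integrable_combination (a b : R) (f1 f2 f3 : Omega -> R) (A : set Omega) :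
  measurable A -> mu.-integrable A (EFin \o f1) -> mu.-integrable A (EFin \o f2) ->
  mu.-integrable A (EFin \o f3) ->
  mu.-integrable A (EFin \o (fun w => a * f1 w + b * f2 w + f3 w)) /\
  Rintegral mu A (fun w => a * f1 w + b * f2 w + f3 w) =
    a * Rintegral mu A f1 + b * Rintegral mu A f2 + Rintegral mu A f3.
Proof.
move=> mA i1 i2 i3.
have j1 : mu.-integrable A (EFin \o (fun w => a * f1 w)) := integrableZl mA a i1.
have j2 : mu.-integrable A (EFin \o (fun w => b * f2 w)) := integrableZl mA b i2.
have j12 : mu.-integrable A (EFin \o (fun w => a * f1 w + b * f2 w)) := integrableD mA j1 j2.
split; first exact: (integrableD mA j12 i3).
by rewrite RintegralD// RintegralD// !RintegralZl.
Qed.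

Lemma weak_cvg_combination (a b : R) (u1 u2 u3 : nat -> Omega -> R) g1 g2 g3 :
  (forall n, mu.-integrable setT (EFin \o u1 n)) ->
  (forall n, mu.-integrable setT (EFin \o u2 n)) ->
  (forall n, mu.-integrable setT (EFin \o u3 n)) ->
  weak_cvg u1 g1 -> weak_cvg u2 g2 -> weak_cvg u3 g3 ->
  weak_cvg (fun n w => a * u1 n w + b * u2 n w + u3 n w)
    (fun w => a * g1 w + b * g2 w + g3 w).
Proof.
move=> i1 i2 i3 [m1 j1 c1] [m2 j2 c2] [m3 j3 c3]; split.
- by apply: measurable_funD => //; apply: measurable_funD; apply: measurable_funM.
- exact: (integrable_combination a b measurableT j1 j2 j3).1.
- move=> A mA; rewrite (_ : (fun n => _) = (fun n => a * Rintegral mu A (u1 n)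
      + b * Rintegral mu A (u2 n) + Rintegral mu A (u3 n))).
    have [_ ->] := integrable_combination a b mA (integrable_sub mA j1)
      (integrable_sub mA j2) (integrable_sub mA j3).
    by apply: cvgD; [apply: cvgD; apply: cvgMr; [exact: c1|exact: c2]|exact: c3].
  apply/funext => n; have [_ ->//] := integrable_combination a b mA
    (integrable_sub mA (i1 n)) (integrable_sub mA (i2 n)) (integrable_sub mA (i3 n)).
Qed.

Variable k : scalar_kind.
Local Notation K := (scalars R k).
Variable F : normedModType K.
Variable Phi : nat -> Omega -> dual F.
Hypothesis Phi1 : forall n w, rnorm (Phi n w) <= 1.
Hypothesis mPhi : forall n y, scalar_measurable (fun w => Phi n w y : K^o).

Let re_Phi y n w := re_part (Phi n w y : K).
Let im_Phi y n w := im_part (Phi n w y : K).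

Let Phi_bound y n w : rnorm (Phi n w y : K^o) <= rnorm y.
Proof. by rewrite (le_trans (dual_bound _ _))// ler_piMl// rnorm_ge0. Qed.

Let re_bound y n w : `|re_Phi y n w| <= rnorm y.
Proof. exact: le_trans (re_part_le _) (Phi_bound _ _ _). Qed.

Let im_bound y n w : `|im_Phi y n w| <= rnorm y.
Proof. exact: le_trans (im_part_le _) (Phi_bound _ _ _). Qed.

Let re_int y n : mu.-integrable setT (EFin \o re_Phi y n).
Proof. exact: bounded_integrableT (mPhi n y).1 (re_bound y n). Qed.

Let im_int y n : mu.-integrable setT (EFin \o im_Phi y n).
Proof. exact: bounded_integrableT (mPhi n y).2 (im_bound y n). Qed.

Let is_limit (y : F) (v : Linf k mu) := exists g h,
  [/\ weak_cvg (re_Phi y) g, weak_cvg (im_Phi y) h &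
      Linf_val v = (fun w => of_parts (g w) (h w)) %[ae mu]].

Let weak_cvg_bound u g M : weak_cvg u g -> (forall n, measurable_fun setT (u n)) ->
  (forall n w, `|u n w| <= M) -> \forall w \ae mu, `|g w| <= M.
Proof.
move=> ug mu_ uM.
have iu n := bounded_integrableT (mu_ n) (uM n).
have ic (c : R) (n : nat) : mu.-integrable setT (EFin \o cst c) by case: (weak_cvg_cst c).
have h1 := weak_cvg_le measurableT ug (weak_cvg_cst M) iu (ic M).
have h2 := weak_cvg_le measurableT (weak_cvg_cst (- M)) ug (ic (- M)) iu.
apply: filterS2 (h1 _) (h2 _) => [w gM Mg||].
- by rewrite ler_norml Mg// gM.
- by apply: nearW => n w _; have := uM n w; rewrite ler_norml => /andP[].
- by apply: nearW => n w _; have := uM n w; rewrite ler_norml => /andP[].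
Qed.

Let limit_exists y : exists v, is_limit y v.
Proof.
have [g gP] := weak_cvg_exists (fun n => (mPhi n y).1) (re_bound y).
have [h hP] := weak_cvg_exists (fun n => (mPhi n y).2) (im_bound y).
have gb := weak_cvg_bound gP (fun n => (mPhi n y).1) (re_bound y).
have hb := weak_cvg_bound hP (fun n => (mPhi n y).2) (im_bound y).
have [mg _ _] := gP; have [mh _ _] := hP.
have [|||v vP] := @Linf_of_fun _ _ _ k mu (fun w => of_parts (g w) (h w)) (rnorm y + rnorm y).
- by rewrite addr_ge0// rnorm_ge0.
- split; first by rewrite (_ : _ \o _ = g)//; apply/funext => w; exact: re_of_parts.
  by rewrite /of_parts; case: (k); [exact: measurable_cst|exact: mh].
- apply: filterS2 gb hb => w gw hw; apply: le_trans (rnorm_le_parts _) _.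
  by rewrite re_of_parts lerD// (le_trans (im_of_parts_bound _ _ _)).
by exists v, g, h.
Qed.

(** Uniqueness makes the arbitrary choice of limits linear in y. *)
Let limit_unique y v v' : is_limit y v -> is_limit y v' -> v = v'.
Proof.
move=> [g [h [yg yh vE]]] [g' [h' [yg' yh' vE']]]; apply: Linf_val_inj.
have hg := weak_cvg_unique yg yg' (re_int y).
have hh := weak_cvg_unique yh yh' (im_int y).
apply: filterS2 (filterI vE vE') (filterI hg hh) => w [e1 e2] [e3 e4] _.
by rewrite e1// e2// e3// e4.
Qed.

Let limit_linear a y y' v v' : is_limit y v -> is_limit y' v' ->
  is_limit (a *: y + y') (a *: v + v').
Proof.
move=> [g [h [yg yh vE]]] [g' [h' [yg' yh' vE']]].
exists (fun w => re_part a * g w + (- im_part a) * h w + g' w),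
  (fun w => re_part a * h w + im_part a * g w + h' w); split.
- rewrite (_ : re_Phi _ = fun n w => re_part a * re_Phi y n w
      + (- im_part a) * im_Phi y n w + re_Phi y' n w); first exact: weak_cvg_combination.
  apply/funext => n; apply/funext => w; rewrite /re_Phi (linearP (Phi n w)) re_partD.
  by rewrite [X in X + _]re_partM mulNr.
- rewrite (_ : im_Phi _ = fun n w => re_part a * im_Phi y n w
      + im_part a * re_Phi y n w + im_Phi y' n w); first exact: weak_cvg_combination.
  apply/funext => n; apply/funext => w; rewrite /im_Phi (linearP (Phi n w)) im_partD.
  by rewrite [X in X + _]im_partM.
- have e1 := Linf_val_add (a *: v) v'; have e2 := Linf_val_scale a v.
  apply: filterS2 (filterI e1 e2) (filterI vE vE') => w [e3 e4] [e5 e6] _.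
  rewrite e3//= e4//= e5// e6// mulNr; exact: of_parts_linear.
Qed.

(* F need not be separable, so pointwise limits of w |-> Phi n w y along an
   ultrafilter need not be measurable in w; their weak* limit in L_oo, a
   Radon-Nikodym density, is still linear in y. *)
Lemma weak_limit_operator : exists S : operator F (Linf k mu),
  forall y (A : set Omega) (a : R), measurable A ->
    ((\forall n \near U, forall w, A w -> a <= re_part (Phi n w y : K)) ->
     \forall w \ae mu, A w -> a <= re_part (Linf_val (S y) w : K)) /\
    ((\forall n \near U, forall w, A w -> re_part (Phi n w y : K) <= a) ->
     \forall w \ae mu, A w -> re_part (Linf_val (S y) w : K) <= a).
Proof.
have /choice[S SP] := limit_exists.
have SL : linear S.
  by move=> a y y'; apply: limit_unique (SP _) _; exact: limit_linear.
have Sb : S \in @bounded_linear _ _ F (Linf k mu).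
  (* The bound 2 adds up the real and imaginary parts. *)
  apply/bounded_linearP; split=> //; exists 2 => // y.
  apply/rnorm_Linf_leP; first by rewrite mulr_ge0// rnorm_ge0.
  have [g [h [yg yh vE]]] := SP y.
  have gb := weak_cvg_bound yg (fun n => (mPhi n y).1) (re_bound y).
  have hb := weak_cvg_bound yh (fun n => (mPhi n y).2) (im_bound y).
  apply: filterS2 vE (filterI gb hb) => w -> // [gw hw].
  apply: le_trans (rnorm_le_parts _) _.
  rewrite mulr_natl mulr2n re_of_parts lerD//.
  by rewrite (le_trans (im_of_parts_bound _ _ _)).
exists (Operator Sb) => y A a mA /=.
have [g [h [yg yh vE]]] := SP y.
have ic (n : nat) : mu.-integrable setT (EFin \o cst a) by case: (weak_cvg_cst a).
split=> aPhi.
  have := weak_cvg_le mA (weak_cvg_cst a) yg ic (re_int y) aPhi.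
  by apply: filterS2 vE => w -> //; rewrite re_of_parts.
have := weak_cvg_le mA yg (weak_cvg_cst a) (re_int y) ic aPhi.
by apply: filterS2 vE => w -> //; rewrite re_of_parts.
Qed.

End WeakLimit.

(** * Asplund operators have no Szlenk-perfect sets *)

Section DyadicMeasure.
Variable R : realType.

Definition unit_lebesgue : set (measurableTypeR R) -> \bar R :=
  mrestr (@lebesgue_measure R) (measurable_itv `[0%R, 1%R[).

HB.instance Definition _ := Measure.on unit_lebesgue.

Lemma unit_lebesgueT : unit_lebesgue setT = 1%E.
Proof.
rewrite /unit_lebesgue /mrestr setTI lebesgue_measure_itv /= lte_fin ltr01.
by rewrite sube0.
Qed.

Lemma unit_lebesgue_finite : fin_num_fun unit_lebesgue.
Proof.
move=> A mA; rewrite ge0_fin_numE ?measure_ge0//.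
apply: le_lt_trans (_ : (unit_lebesgue setT < +oo)%E); last by rewrite unit_lebesgueT ltry.
by apply: le_measure; rewrite ?inE.
Qed.

HB.instance Definition _ := Measure_isFinite.Build _ _ _ unit_lebesgue unit_lebesgue_finite.

Lemma unit_lebesgue_set1 (x : R) : unit_lebesgue [set x] = 0%E.
Proof.
apply/eqP; rewrite -measure_le0 -(lebesgue_measure_set1 x) /unit_lebesgue /mrestr.
apply: le_measure; rewrite ?inE//; exact: measurableI.
Qed.

Lemma unit_lebesgue_itv : \forall w \ae unit_lebesgue, 0 <= w < 1.
Proof.
exists (~` [set` `[0%R, 1%R[]); split.
- by apply: measurableC; exact: measurable_itv.
- rewrite /unit_lebesgue /mrestr setICl measure0//.
- by move=> w /= h; rewrite in_itv.
Qed.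

(** For w >= 0, the index j of the interval [j / 2^n, (j + 1) / 2^n[ around w. Negative numbers get
    the index 0, whence the condition 0 <= w in what follows. *)
Definition dyadic (n : nat) (w : R) : nat := Num.truncn (2 ^+ n * w).

Lemma dyadic_ge0 n w : 0 <= w -> 0 <= 2 ^+ n * w :> R.
Proof. by move=> w0; rewrite mulr_ge0// exprn_ge0. Qed.

Lemma dyadic_div m n w : 0 <= w -> (dyadic (m + n) w %/ 2 ^ m)%N = dyadic n w.
Proof.
move=> w0; rewrite /dyadic; apply/esym/truncn_def.
set y := 2 ^+ n * w; have yE : 2 ^+ (m + n) * w = (2 ^ m)%:R * y.
  by rewrite /y mulrA natrX exprD.
have m0 : 0 < (2 ^ m)%:R :> R by rewrite ltr0n expn_gt0.
have y0 : 0 <= (2 ^ m)%:R * y by rewrite -yE dyadic_ge0.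
rewrite yE; set t := Num.truncn _; have /andP[t1 t2] := truncn_itv y0.
apply/andP; split.
  rewrite -(ler_pM2l m0); apply: le_trans t1; rewrite -natrM ler_nat mulnC.
  exact: leq_trunc_div.
rewrite -(ltr_pM2l m0); apply: lt_le_trans t2 _; rewrite -natrM ler_nat mulnC.
by rewrite ltn_ceil// expn_gt0.
Qed.

Lemma dyadic_measurable n j : measurable [set w : measurableTypeR R | 0 <= w /\ dyadic n w = j].
Proof.
rewrite (_ : [set _ | _] = [set` `[j%:R / 2 ^+ n, j.+1%:R / 2 ^+ n[]); first exact: measurable_itv.
have n0 : 0 < 2 ^+ n :> R by rewrite exprn_gt0.
apply/seteqP; split=> w /=; rewrite in_itv /= ler_pdivrMr// ltr_pdivlMr// ![w * _]mulrC.
  by move=> [w0 <-]; exact/truncn_itv/dyadic_ge0.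
move=> h; split; last exact: truncn_def.
by rewrite -(pmulr_rge0 _ n0); apply: le_trans (proj1 (andP h)).
Qed.

(** At level 0 all points of [0, 1[ have index 0; the least level at which the indices differ is
    therefore a successor. *)
Lemma dyadic_separates w w' : 0 <= w < 1 -> 0 <= w' < 1 -> w != w' ->
  exists n, dyadic n w = dyadic n w' /\ dyadic n.+1 w != dyadic n.+1 w'.
Proof.
move=> /andP[w0 w1] /andP[w'0 w'1] ww'.
have ex : exists n, dyadic n w != dyadic n w'.
  have d0 : 0 < `|w - w'| by rewrite normr_gt0 subr_eq0.
  have [n0 nP] := half_pow_lt d0; exists n0; have := nP n0 (leqnn _).
  rewrite exprVn -[_^-1]div1r ltr_pdivrMr ?exprn_gt0// => h.
  apply/eqP => e; move: h; rewrite ltNge => /negP; apply.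
  have /andP[h1 h2] := truncn_itv (dyadic_ge0 n0 w0).
  have /andP[h3 h4] := truncn_itv (dyadic_ge0 n0 w'0).
  rewrite -/(dyadic _ _) in h1 h2; rewrite -/(dyadic _ _) -e in h3 h4.
  rewrite -(ger0_norm (exprn_ge0 n0 (ler0n R 2))) mulrC -normrM mulrBr ler_norml.
  move: h1 h2 h3 h4; rewrite -[(dyadic n0 w).+1%:R]natr1.
  move: (2 ^+ n0 * w) (2 ^+ n0 * w') (dyadic n0 w)%:R => a b c *.
  by apply/andP; split; lra.
case: (ex_minnP ex) => -[|n] nw nmin.
  by move: nw; rewrite /dyadic !expr0 !mul1r !(@truncn_def _ _ 0) ?w0 ?w'0.
exists n; split=> //; apply/eqP/negPn/negP => /nmin; by rewrite ltnn.
Qed.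

End DyadicMeasure.

(** * Small oscillation, finite nets and slices *)

(** The functions are treated one at a time: countably many sets |h - q n| <= e / 2 cover the
    current set, so one of them meets it in positive measure. *)
Lemma small_oscillation (d : measure_display) (Omega : measurableType d) (R : realType)
    (mu : {measure set Omega -> \bar R}) (hs : seq (Omega -> R)) (A : set Omega) (e : R) :
  0 < e -> measurable A -> mu A != 0%E ->
  (forall i, (i < size hs)%N -> measurable_fun setT (nth (cst 0) hs i)) ->
  exists A', [/\ measurable A', mu A' != 0%E, A' `<=` A &
    forall i, (i < size hs)%N -> forall w w', A' w -> A' w' ->
      `|nth (cst 0) hs i w - nth (cst 0) hs i w'| <= e].
Proof.
move=> e0; elim: hs A => [|h hs IH] A mA A0 mh; first by exists A; split.
have [A' [mA' A'0 A'A oscA']] := IH A mA A0 (fun i => mh i.+1).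
have [q qdense] := dense_scalars R RealScalars.
pose C n := A' `&` [set w | `|h w - q n| <= cst (e / 2) w].
have mC n : measurable (C n).
  apply: measurable_fun_le => //; apply: measurable_funTS => //.
  apply: measurableT_comp => //; apply: measurable_funB => //; exact: (mh 0%N).
have [n Cn0] : exists n, mu (C n) != 0%E.
  apply: contrapT => no.
  have Cneg : mu.-negligible (\bigcup_n C n).
    apply: negligible_bigcup => n; apply/negligibleP; first exact: mC.
    by apply/eqP/negPn/negP => Cn; apply: no; exists n.
  suff h0 : mu A' = 0%E by rewrite h0 eqxx in A'0.
  apply/negligibleP => //; apply: negligibleS Cneg => w A'w.
  have [n hn] := qdense (h w) _ (divr_gt0 e0 (ltr0Sn R 1)).
  by exists n => //; split=> //; apply: ltW; exact: hn.
exists (C n); split=> //; first by move=> w [/A'A].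
move=> [_ w w' [_ hw] [_ hw']|i iN w w' [Aw _] [Aw' _]]; last exact: oscA'.
rewrite /= in hw hw' *; rewrite -(subrKA (q n)) (le_trans (ler_normD _ _))//.
by rewrite [leRHS](splitr e) lerD// distrC.
Qed.

Lemma precompact_finite_net (R : realType) (k : scalar_kind)
    (V : normedModType (scalars R k)) (C : set V) (e : R) : 0 < e -> precompact C ->
  exists s : seq V, forall x, C x -> exists2 i, (i < size s)%N & rnorm (x - nth 0 s i) < e.
Proof.
move=> e0; rewrite precompactE compact_cover => /(_ V setT (fun c => [set x | rnorm (x - c) < e])).
case.
- move=> c _; rewrite openE => x /= xe; apply/nbhs_rnormP.
  exists (e - rnorm (x - c)); first by rewrite subr_gt0.
  move=> y xy /=; rewrite (le_lt_trans (rnorm_triangle x _ _))//.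
  by rewrite -ltrBrDr rnormB.
- by move=> x _; exists x => //=; rewrite subrr rnorm0.
move=> D _ CD; pose s : seq V := finmap.enum_fset D; exists s => x Cx.
have [c /= cD xc] := CD x (subset_closure Cx).
by exists (index c s); [rewrite index_mem|rewrite nth_index].
Qed.

Section SliceSplitting.
Variables (R : realType) (k : scalar_kind).
Local Notation K := (scalars R k).
Variable E : normedModType K.

(** Two points of L in V are more than e apart in norm, hence at some x of the unit ball, and after
    a rotation in real part. Moving both thresholds inwards by e / 4 leaves a gap of e / 2. *)
Lemma slice_split (L : set (dual E)) (e : R) (V : set (weak_star E)) : 0 < e ->
  L `<=` szlenk_derivative e L -> open V -> L `&` V !=set0 ->
  exists x a b, [/\ rnorm x <= 1, a + e / 2 <= b,
    L `&` (V `&` [set phi : dual E | re_part (phi x) < a]) !=set0 &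
    L `&` (V `&` [set phi : dual E | b < re_part (phi x)]) !=set0].
Proof.
move=> e0 Lsub oV [y [Ly Vy]].
have [_ /(_ V oV Vy)] := Lsub y Ly.
move=> /ereal_sup_gt[_ [[p q] [[Lp Vp] [Lq Vq]] <-]]; rewrite lte_fin /= => epq.
have [_ [x /closed_unit_ballP x1 <-] ex] : exists2 r,
    [set rnorm ((p - q : dual E) x : K^o) | x in closed_unit_ball E] r & e < r.
  apply: sup_gt; last by rewrite rnorm_operator in epq.
  by exists (rnorm ((p - q : dual E) 0 : K^o)), 0 => //; apply/closed_unit_ballP; rewrite rnorm0.
have [a a1 ax] := rotation ((p - q : dual E) x).
have pq : e < re_part (p (a *: x)) - re_part (q (a *: x)).
  rewrite -re_partB; have -> : p (a *: x) - q (a *: x) = a * (p - q : dual E) x.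
    by rewrite (linearZ_LR p) (linearZ_LR q); exact/esym/(@mulrBr K).
  by rewrite ax re_of_real.
exists (a *: x), (re_part (q (a *: x)) + e / 4), (re_part (p (a *: x)) - e / 4); split.
- by rewrite rnormZ a1 mul1r.
- by move: (re_part (p _)) (re_part (q _)) pq => u v; lra.
- by exists q; split=> //; split=> //=; rewrite ltrDl divr_gt0.
- by exists p; split=> //; split=> //=; rewrite gtrBl divr_gt0.
Qed.
End SliceSplitting.

Lemma measurable_dyadic_comp (R : realType) n (h : nat -> R) :
  measurable_fun [set: measurableTypeR R] (fun w => h (dyadic n w)).
Proof.
have mj j : measurable [set w : measurableTypeR R | dyadic n w = j].
  have [j0|j0] := eqVneq j 0%N.
    rewrite (_ : [set _ | _] = [set w : measurableTypeR R | 0 <= w /\ dyadic n w = j] `|` [set` `]-oo, 0%R[]).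
      by apply: measurableU; [exact: dyadic_measurable|exact: measurable_itv].
    apply/seteqP; split=> w /=; rewrite in_itv /=.
      by have [w0|w0] := lerP 0 w; [left|right].
    case=> [[]//|w0]; rewrite j0 /dyadic; apply/eqP; rewrite -leqn0 truncn_le_nat.
    by rewrite (@lt_trans _ _ 0)// nmulr_llt0 // exprn_gt0.
  rewrite (_ : [set _ | _] = [set w : measurableTypeR R | 0 <= w /\ dyadic n w = j]).
    exact: dyadic_measurable.
  apply/seteqP; split=> w /=; last by case.
  move=> wj; split=> //; rewrite leNgt; apply/negP => w0; move: j0; rewrite -wj -lt0n truncn_gt0.
  by rewrite leNgt (@lt_trans _ _ 0)// nmulr_llt0// exprn_gt0.
move=> _ Y mY; rewrite setTI.
rewrite (_ : _ @^-1` Y = \bigcup_(j in [set j | Y (h j)]) [set w | dyadic n w = j]).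
  by apply: bigcup_measurable => j _; exact: mj.
apply/seteqP; split=> [w Yw|w [j /= Yj wj]]; first by exists (dyadic n w).
by rewrite /= wj.
Qed.

(** * The dyadic tree of slices and its limit operator *)

Section AsplundNoPerfect.
Variables (R : realType) (k : scalar_kind).
Local Notation K := (scalars R k).
Variables E F : normedModType K.
Variable T : operator E F.

(* The slices [node n j], j < 2 ^ n, form a dyadic tree in which the two children of
   V are separated by more than e / 2 at the point [X V]. At w in [0, 1[, the operator
   S is the weak* limit of functionals taken in the nodes indexed by the dyadic
   intervals around w, so the functions S (T (X V)) cannot all have small oscillation
   on a set with two points. *)
Lemma asplund_no_perfect (e : R) (L : set (dual E)) : asplund E F T -> 0 < e ->
  L `<=` adjoint_ball T -> L !=set0 -> ~ L `<=` szlenk_derivative e L.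
Proof.
move=> AT e0 LK L0 Lsub.
have /choice[ch chP] (V : set (weak_star E)) : exists c : E * (R * R),
    open V -> L `&` V !=set0 -> [/\ rnorm c.1 <= 1, c.2.1 + e / 2 <= c.2.2,
    L `&` (V `&` [set phi : dual E | re_part (phi c.1) < c.2.1]) !=set0 &
    L `&` (V `&` [set phi : dual E | c.2.2 < re_part (phi c.1)]) !=set0].
  have [[oV LV]|no] := EM (open V /\ L `&` V !=set0); last first.
    by exists (0, (0, 0)) => oV LV; case: no.
  by have [x [a [b h]]] := slice_split e0 Lsub oV LV; exists (x, (a, b)).
pose X V := (ch V).1; pose lo V := (ch V).2.1; pose hi V := (ch V).2.2.
pose child (c : bool) (V : set (weak_star E)) : set (weak_star E) := V `&`
  (if c then [set phi : dual E | hi V < re_part (phi (X V))]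
   else [set phi : dual E | re_part (phi (X V)) < lo V]).
(* The parent of node j is node [j./2], and the parity of j tells which child it is, as for dyadic
   intervals. *)
pose node := fix node (n j : nat) : set (weak_star E) :=
  if n is m.+1 then child (odd j) (node m j./2) else setT.
have nodeP n j : open (node n j) /\ L `&` node n j !=set0.
  elim: n j => [|n IH] j /=; first by rewrite setIT; split=> //; exact: openT.
  have [oV LV] := IH j./2; have [_ _ h1 h2] := chP _ oV LV.
  rewrite /child; case: (odd j); split=> //; apply: openI => //.
    exact: (weak_star_re_open _ (@open_gt _ _)).
  exact: (weak_star_re_open _ (@open_lt _ _)).
have nodeS m n j : node (m + n)%N j `<=` node n (j %/ 2 ^ m)%N.
  elim: m j => [|m IH] j; first by rewrite divn1.
  rewrite addSn expnS divnMA divn2 => phi [hphi _]; exact: IH hphi.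
have /choice[f fP] (p : nat * nat) : exists f : dual F,
    rnorm f <= 1 /\ node p.1 p.2 (adjoint T f).
  have [phi [Lphi nphi]] := (nodeP p.1 p.2).2.
  by have [g /closed_unit_ballP g1 gphi] := LK _ Lphi; exists g; rewrite gphi.
have [U [UU Uev]] := ultraFilterLemma eventually_filter.
have UP : ProperFilter U by exact: ultra_proper.
have [mu [muT mu1 ae0]] : exists mu : {finite_measure set (measurableTypeR R) -> \bar R},
    [/\ mu setT = 1%E, forall x, mu [set x] = 0%E & \forall w \ae mu, 0 <= w < 1].
  exists (@unit_lebesgue R).
  by split; [exact: unit_lebesgueT|exact: unit_lebesgue_set1|exact: unit_lebesgue_itv].
(* The functionals are lifted to F, where S has to act; they depend on w only through a dyadic
   index, hence are measurable. *)
pose Phi n (w : measurableTypeR R) := f (n, dyadic n w).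
have [||S SP] := @weak_limit_operator _ _ _ mu U UP UU k F Phi.
- by move=> n w; exact: (fP _).1.
- by move=> n y; split; [exact: (measurable_dyadic_comp n (fun j => re_part (f (n, j) y : K)))
    |exact: (measurable_dyadic_comp n (fun j => im_part (f (n, j) y : K)))].
pose I n j := [set w : measurableTypeR R | 0 <= w /\ dyadic n w = j].
pose v n j w := re_part (Linf_val (S (T (X (node n j)))) w : K).
have in_node n j N w : (n <= N)%N -> I n j w -> node n j (adjoint T (Phi N w)).
  move=> nN [w0 wj]; have := (fP (N, dyadic N w)).2 => /=.
  by rewrite -{1}(subnK nN) => /nodeS; rewrite -{1}(subnK nN) dyadic_div// wj.
have near_n n : U [set N | (n <= N)%N] by apply: Uev; exists n.
(* For N > n the functional at w lies in node (n + 1, j), so the inequality holds for all late N and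
   passes to the limit along U. *)
have sep n j : \forall w \ae mu, I n.+1 j w ->
    if odd j then hi (node n j./2) <= v n j./2 w else v n j./2 w <= lo (node n j./2).
  have := SP (T (X (node n j./2))) (I n.+1 j) _ (dyadic_measurable n.+1 j).
  case oj: (odd j) => h.
    apply: (h _).1; apply: filterS (near_n n.+1) => N nN w Iw.
    by have [_] := in_node _ _ _ _ nN Iw; rewrite oj => /ltW.
  apply: (h _).2; apply: filterS (near_n n.+1) => N nN w Iw.
  by have [_] := in_node _ _ _ _ nN Iw; rewrite oj => /ltW.
(* The tolerance 1 is the total mass, which makes the measure of B positive. *)
have [B [mB muB cB]] := AT _ _ mu S 1 ltr01.
have B0 : mu B != 0%E.
  by apply: contraTneq muB => ->; rewrite -leNgt muT subee.
have d0 : 0 < e / 8 by rewrite divr_gt0.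
have [gs gsP] := precompact_finite_net d0 cB.
pose hs := [seq (re_part \o Linf_val g : measurableTypeR R -> R) | g <- gs].
have [|A [mA A0 AB oscA]] := @small_oscillation _ _ _ mu hs B _ d0 mB B0.
  move=> i; rewrite size_map => ig; rewrite (nth_map 0)//.
  exact: (Linf_scalar_measurable _).1.
have approx n j : exists i, (i < size gs)%N /\
    \forall w \ae mu, B w -> `|v n j w - re_part (Linf_val (nth 0 gs i) w)| <= e / 8.
  have [oV LV] := nodeP n j; have [x1 _ _ _] := chP _ oV LV.
  pose u := S (T (X (node n j))).
  have uB w : Linf_val u w * \1_B w = if w \in B then Linf_val u w else 0.
    by rewrite indicE; case: (w \in B); rewrite ?mulr1 ?mulr0.
  have [|||g gE] := @Linf_of_fun _ _ _ k mu (fun w => Linf_val u w * \1_B w) (rnorm u).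
  - exact: rnorm_ge0.
  - have [mr mi] := Linf_scalar_measurable u; split.
      rewrite (_ : _ \o _ = (fun w => re_part (Linf_val u w) * \1_B w)).
        by apply: measurable_funM => //; exact: measurable_indic.
      by apply/funext => w; rewrite /= uB indicE; case: (w \in B); rewrite ?mulr1 ?mulr0// re_part0.
    rewrite (_ : _ \o _ = (fun w => im_part (Linf_val u w) * \1_B w)).
      by apply: measurable_funM => //; exact: measurable_indic.
    by apply/funext => w; rewrite /= uB indicE; case: (w \in B); rewrite ?mulr1 ?mulr0// im_part0.
  - apply: filterS (Linf_ae_le u) => w uw; rewrite uB; case: ifP => // _.
    by rewrite rnorm0 rnorm_ge0.
  have [|i igs gi] := gsP g.
    exists u => //; exists (X (node n j)) => //; exact/closed_unit_ballP.
  exists i; split=> //.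
  have gi' := (rnorm_Linf_leP (g - nth 0 gs i) (ltW d0)).1 (ltW gi).
  move: gE gi' (Linf_val_sub g (nth 0 gs i)); apply: filterS3 => w /(_ Logic.I) gw hw sw Bw.
  move: hw; rewrite sw gw uB mem_set// => hw.
  rewrite /v -re_partB; exact: le_trans (re_part_le _) hw.
have /choice[idx idxP] (p : nat * nat) : exists i, (i < size gs)%N /\
    \forall w \ae mu, B w -> `|v p.1 p.2 w - re_part (Linf_val (nth 0 gs i) w)| <= e / 8.
  exact: approx.
have ae1 : \forall w \ae mu, forall n j, I n.+1 j w ->
    if odd j then hi (node n j./2) <= v n j./2 w else v n j./2 w <= lo (node n j./2).
  by apply: ae_foralln => n; apply: ae_foralln => j; exact: sep.
have ae2 : \forall w \ae mu, forall n j, B w ->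
    `|v n j w - re_part (Linf_val (nth 0 gs (idx (n, j))) w)| <= e / 8.
  by apply: ae_foralln => n; apply: ae_foralln => j; exact: (idxP (n, j)).2.
pose good (w : measurableTypeR R) := [/\ 0 <= w < 1, forall n j, I n.+1 j w ->
    if odd j then hi (node n j./2) <= v n j./2 w else v n j./2 w <= lo (node n j./2) &
  forall n j, B w -> `|v n j w - re_part (Linf_val (nth 0 gs (idx (n, j))) w)| <= e / 8].
have : \forall w \ae mu, good w.
  pose unit_itv (w : measurableTypeR R) := 0 <= w < 1.
  have {}ae0 : \forall w \ae mu, unit_itv w by exact: ae0.
  by move: ae0 ae1 ae2; apply: filterS3 => w *; split.
move=> [N [mN N0 NP]].
have AN : ~ mu.-negligible (A `\` N).
  move=> AN; have : mu.-negligible A.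
    apply: (@negligibleS _ _ _ _ (A `\` N `|` N)).
      by move=> w Aw; have [Nw|Nw] := EM (N w); [right|left].
    by apply: negligibleU => //; apply/negligibleP.
  by move=> /(negligibleP _ mA) h; rewrite h eqxx in A0.
have goodN w : ~ N w -> good w by move=> nN; apply: contrapT => ng; apply: nN; exact: NP.
have [w [Aw Nw]] : A `\` N !=set0.
  by apply/set0P/eqP => AN0; apply: AN; rewrite AN0; exact: negligible_set0.
(* A set that is not negligible cannot be a singleton. *)
have [w' [Aw' Nw'] ww'] : exists2 w', (A `\` N) w' & w != w'.
  apply: contrapT => no; apply: AN; apply: (@negligibleS _ _ _ _ [set w]).
    by move=> w' Aw'; apply/esym/eqP/negPn/negP => ww'; apply: no; exists w'.
  by apply/negligibleP => //; exact: mu1.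
have [w01 gw1 gw2] := goodN _ Nw; have [w'01 gw'1 gw'2] := goodN _ Nw'.
have [n [nww' nSww']] := dyadic_separates w01 w'01 ww'.
have /andP[w0 _] := w01; have /andP[w'0 _] := w'01.
have half u : 0 <= u -> (dyadic n.+1 u)./2 = dyadic n u.
  by move=> u0; rewrite -(dyadic_div 1 n u0) expn1 divn2.
have hw := gw1 n _ (conj w0 erefl); have hw' := gw'1 n _ (conj w'0 erefl).
rewrite half// in hw; rewrite half// -nww' in hw'.
set m := dyadic n w in hw hw'.
have h1 := gw2 n m (AB _ Aw); have h2 := gw'2 n m (AB _ Aw').
have h3 : `|re_part (Linf_val (nth 0 gs (idx (n, m))) w)
          - re_part (Linf_val (nth 0 gs (idx (n, m))) w')| <= e / 8.
  have ig := (idxP (n, m)).1.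
  have := oscA (idx (n, m)); rewrite size_map (nth_map 0)// => /(_ ig w w' Aw Aw').
  exact.
have [oV LV] := nodeP n m; have [_ lohi _ _] := chP _ oV LV.
have odds : odd (dyadic n.+1 w) != odd (dyadic n.+1 w').
  apply: contraNneq nSww' => oo.
  by rewrite -(odd_double_half (dyadic n.+1 w)) -(odd_double_half (dyadic n.+1 w'))
    oo !half// nww'.
(* The points w and w' lie in different children of the node m, so the two values differ by at least
   e / 2; two approximations and one oscillation allow only 3 e / 8. *)
move: h1 h2 h3 hw hw' odds lohi; rewrite !ler_norml -/(lo _) -/(hi _).
move: (re_part _) (re_part _) (v n m w) (v n m w') (lo _) (hi _) => a b c c' l r.
move=> /andP[? ?] /andP[? ?] /andP[? ?].
by case: (odd _) => ?; case: (odd _) => ? // _ ?; lra.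
Qed.

End AsplundNoPerfect.

Theorem proposition2p11 (R : realType) (k : scalar_kind)
    (E F : completeNormedModType (scalars R k)) :
  [/\ dual_range_separable E F = separable_range E F `&` asplund E F,
      separable_range E F `&` asplund E F
        = separable_range E F
            `&` [set T : operator E F | exists a : ord, SZ a T],
      separable_range E F `&` [set T : operator E F | exists a : ord, SZ a T]
        = separable_range E F
            `&` [set T : operator E F |
                  exists2 a : ord, olt a omega1 & SZ a T] &
      separable_range E F
          `&` [set T : operator E F | exists2 a : ord, olt a omega1 & SZ a T]
        = separable_range E F `&` SZ omega1].
Proof.
have dual_asplund : dual_range_separable E F `<=` separable_range E F `&` asplund E F.
  by move=> T T1; split; [exact: dual_range_separable_sub|exact: dual_range_separable_asplund].
(* One countable bound on the index gives both membership in some [SZ a] with a countable and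
   membership in [SZ omega1]. *)
have asplund_index (T : operator E F) : separable_range E F T -> asplund E F T ->
    exists2 a, olt a omega1 & forall b, Sz_op T b -> olt b a.
  move=> sT AT; apply: countable_szlenk_index => // e L e0 LK L0.
  exact: (asplund_no_perfect AT e0 LK L0).
have index_dual T : separable_range E F T -> (exists a, SZ a T) -> dual_range_separable E F T.
  by move=> sT [a]; exact: szlenk_dual_range_separable.
have asplund_countable (T : operator E F) : separable_range E F T -> asplund E F T ->
    exists2 a, olt a omega1 & SZ a T.
  move=> sT /(asplund_index _ sT)[a a1 aT]; exists a => // b /aT/ole_trans; apply.
  exact: ole_omega_pow.
have asplund_omega1 (T : operator E F) : separable_range E F T -> asplund E F T -> SZ omega1 T.
  move=> sT /(asplund_index _ sT)[a a1 aT] b /aT/ole_trans; apply.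
  exact: ole_trans (oltW a1) (ole_omega_pow _).
have index_asplund T : separable_range E F T -> (exists a, SZ a T) -> asplund E F T.
  by move=> sT /(index_dual T sT)/dual_asplund[].
split; apply/seteqP; split=> T.
- exact: dual_asplund.
- move=> [sT AT]; apply: index_dual => //.
  by have [a _ aT] := asplund_countable T sT AT; exists a.
- move=> [sT AT]; split=> //.
  by have [a _ aT] := asplund_countable T sT AT; exists a.
- by move=> [sT aT]; split=> //; exact: index_asplund.
- by move=> [sT aT]; split=> //; apply: asplund_countable => //; exact: index_asplund.
- by move=> [sT [a _ aT]]; split=> //; exists a.
- move=> [sT [a _ aT]]; split=> //; apply: asplund_omega1 => //.
  by apply: index_asplund => //; exists a.
- move=> [sT oT]; split=> //; apply: asplund_countable => //.
  by apply: index_asplund => //; exists omega1.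
Qed.
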